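(* Let $D\subset\mathbb C^n$ and $G\subset\mathbb C^m$ be domains, and let $z\in D$ and $w,b\in G$. Then for every nonempty at most countable set $A\subset D$, $$\max\{l_D(A,z),\,l_G^{\# A}(b,w)\}\le l_{D\times G}(A\times\{b\},(z,w))\le \max\{l_D(A,z),\,l_G(b,w)\}.$$ Moreover, for given $N\in\mathbb N^*=\{1,2,3,\dots\}\cup\{\infty\}$, the equality $$l_{D\times G}(A\times\{b\},(z,w))=\max\{l_D(A,z),\,l_G(b,w)\}$$ holds for every $A\subset D$ with $N$ elements if and only if $l_G(b,w)=l_G^N(b,w)$.
   Context: $\mathbb D$ is the open unit disc in $\mathbb C$ and $\mathcal O(\mathbb D,\Omega)$ is the set of holomorphic maps $\mathbb D\to\Omega$. For a domain $\Omega\subset\mathbb C^k$, a point $x\in\Omega$ and a nonempty at most countable set $A\subset\Omega$, the Lempert function with poles at $A$ is $$l_\Omega(A,x)=\inf\Big\{\prod_{a\in A}|\lambda_a|\Big\},$$ the infimum being over all families $(\lambda_a)_{a\in A}$ in $\mathbb D$ for which there is $\phi\in\mathcal O(\mathbb D,\Omega)$ with $\phi(0)=x$ and $\phi(\lambda_a)=a$ for all $a\in A$ (such families exist). Write $l_\Omega(a,x)=l_\Omega(\{a\},x)$. For $N\in\mathbb N^*$ and $a,x\in\Omega$, $$l_\Omega^N(a,x)=\inf\Big\{\prod_{j=1}^N|\lambda_j|\Big\},$$ the infimum being over all families $(\lambda_j)_{j=1}^N$ of pairwise distinct points of $\mathbb D$ for which there is $\phi\in\mathcal O(\mathbb D,\Omega)$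 with $\phi(0)=x$ and $\phi(\lambda_j)=a$ for all $j$. Infinite products are limits of partial products (value $0$ allowed). $\#A$ is the number of elements of $A$, with $\#A=\infty$ if $A$ is countably infinite; ''with $\infty$ elements'' means countably infinite. *)

(* Defs.v *)
From HB Require Import structures.
From mathcomp Require Import all_boot all_order all_algebra.
From mathcomp Require Import all_classical all_reals all_analysis.
From mathcomp Require Import finmap complex.

Set Implicit Arguments.
Unset Strict Implicit.
Unset Printing Implicit Defensive.

Import Order.TTheory GRing.Theory Num.Theory.
Import numFieldNormedType.Exports.

Local Open Scope classical_set_scope.
Local Open Scope ring_scope.

Definition domain (R : realType) (V : normedModType R[i]) (Omega : set V) :
  Prop :=
  [/\ open Omega, connected Omega & Omega !=set0].

(* phi represents an element of O(disc, Omega); its values off the open unit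
   disc are irrelevant.  The limit defining derivable is taken along complex
   increments, so this is complex differentiability.  Note that the norm on
   R[i] takes its values in R[i], where `|zeta| < 1 is the usual comparison. *)
Definition holo_disc (R : realType) (V : normedModType R[i]) (Omega : set V)
    (phi : R[i] -> V) : Prop :=
  forall zeta : R[i], `|zeta| < 1 ->
    Omega (phi zeta) /\ derivable (phi : R[i]^o -> V) zeta 1.

(* An element of {0, 1, 2, ...} U {oo} is an option nat, None standing for oo.
   nb_elem is meaningful on countable sets only: it is None on every infinite
   set. *)
Definition nb_elem (T : choiceType) (A : set T) : option nat :=
  if pselect (finite_set A) is left _ then Some #|` fset_set A|%N else None.

Definition indices (N : option nat) : set nat :=
  if N is Some n then `I_n else setT.

(* The product of the u j for j in indices N exists and is equal to p. *)
Definition is_prod (R : realType) (N : option nat) (u : nat -> R) (p : R) :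
  Prop :=
  if N is Some n then p = \prod_(j < n) u j
  else (fun k : nat => \prod_(j < k) u j) @ \oo --> p.

(* The product of a family over a countable set is computed along an
   enumeration; for factors in [0, 1], as below, p does not depend on it. *)
Definition is_set_prod (R : realType) (T : choiceType) (A : set T)
    (f : T -> R) (p : R) : Prop :=
  exists2 e : nat -> T,
    set_bij (indices (nb_elem A)) A e & is_prod (nb_elem A) (f \o e) p.

(* Normc.normc is the R-valued modulus. *)
Definition lempert (R : realType) (V : normedModType R[i]) (Omega A : set V)
    (x : V) : \bar R :=
  ereal_inf [set p%:E | p in [set p : R |
    exists (lambda : V -> R[i]) (phi : R[i] -> V),
      [/\ forall a, A a -> `|lambda a| < 1,
          holo_disc Omega phi,
          phi 0 = x,
          forall a, A a -> phi (lambda a) = a &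
          is_set_prod A (fun a => Normc.normc (lambda a)) p]]].

Definition lempertN (R : realType) (V : normedModType R[i]) (Omega : set V)
    (N : option nat) (a x : V) : \bar R :=
  ereal_inf [set p%:E | p in [set p : R |
    exists (lambda : nat -> R[i]) (phi : R[i] -> V),
      [/\ (forall j, indices N j -> `|lambda j| < 1) /\
            set_inj (indices N) lambda,
          holo_disc Omega phi,
          phi 0 = x,
          forall j, indices N j -> phi (lambda j) = a &
          is_prod N (fun j => Normc.normc (lambda j)) p]]].

(* Main.v *)
Require Import Defs.
From HB Require Import structures.
From mathcomp Require Import all_boot all_order all_algebra.
From mathcomp Require Import all_classical all_reals all_analysis.
From mathcomp Require Import finmap complex.
From mathcomp Require Import ring lra.

(** The lower bound comes from projecting a disc in D x G to each factor: the
    parameters of its poles are pairwise distinct because the first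
    projection separates them.

    For the upper bound, let phi and psi be competitors for l_D(A,z) and
    l_G(b,w), with pole parameters lambda_j and mu, and let s < 1 be larger
    than both values [prod |lambda_j|] and [|mu|].  It is enough to find
    self-maps g and f of the unit disc fixing 0 and points x_j with
    g(x_j) = lambda_j, f(x_j) = mu and [prod |x_j| <= s], since then
    (phi o g, psi o f) is a competitor for the product domain.  This is
    [disc_interpolation].

    Suppose that the x_j are already chosen in the fibres of g and that
    [q := prod |x_j|] lies between [|mu|] and s.  The Blaschke product B with
    zeros x_j, normalized so that B(0) = q, exists ([Blaschke_product]), and
    f := (mu / q) (q - B) / (1 - q B) takes the value mu wherever B vanishes.
    So everything rests on finding fibre points whose product falls in a
    prescribed window above [prod |lambda_j|].

    For g take the universal covering of a once-punctured disc, namely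
    exp (- t (1 + x) / (1 - x)) followed by the automorphism of the disc that
    brings exp (- t) to 0 ([cover]).  The fibre over any value taken has
    points arbitrarily close to the unit circle ([cover_near_boundary]), so
    all but finitely many poles can be moved so close to the circle that they
    hardly change the product.  On the remaining poles follow the principal
    branch of the logarithm while t varies: the modulus of the fibre point
    over lambda tends to [|lambda|] when t tends to 0 and to 1 when t tends to
    infinity, so that by the intermediate value theorem the finite product
    equals s for some t ([sheet_prod_ivt]).  On the principal branch the point
    over 0 is 0 for all t, so a pole with lambda = 0 needs another branch.
    The parameters must avoid the omitted value and the cut of the logarithm;
    a rotation achieves this for countably many of them
    ([rotation_offslit]).

    In the equivalence, one direction is a squeeze between the two bounds.
    For the other, D is open, so it contains an affine disc centred at z, and
    the image A under it of an arbitrary family of distinct parameters is an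
    admissible set of poles.  Parameters taken from a competitor for l_G^N
    give l_G <= l_G^N; parameters containing 0 give l_D(A,z) = 0, whence
    l_G^N <= l_G.  *)

Set Implicit Arguments.
Unset Strict Implicit.
Unset Printing Implicit Defensive.

Import Order.TTheory GRing.Theory Num.Theory.
Import numFieldNormedType.Exports.

Local Open Scope classical_set_scope.
Local Open Scope ring_scope.
Local Open Scope complex_scope.

Local Notation Re := complex.Re.
Local Notation Im := complex.Im.

(** * Modulus of complex numbers and automorphisms of the disc *)

Section Modulus.
Variable R : realType.
Local Notation C := R[i].
Local Notation normc := (@Normc.normc R).
Implicit Types (x y z : C) (r : R).

Lemma normE z : `|z| = (normc z)%:C. Proof. by []. Qed.

Lemma nc_ge0 z : 0 <= normc z.
Proof. by case: z => a b; rewrite sqrtr_ge0. Qed.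

Lemma nc_sq z : normc z ^+ 2 = Re z ^+ 2 + Im z ^+ 2.
Proof. by case: z => a b; rewrite sqr_sqrtr // addr_ge0 // sqr_ge0. Qed.

Lemma nc_real r : normc r%:C = `|r|.
Proof. by rewrite /= expr0n addr0 sqrtr_sqr. Qed.

Lemma ncN z : normc (- z) = normc z.
Proof. by apply: complexI; rewrite -!normE normrN. Qed.

Lemma ncD x y : normc (x + y) <= normc x + normc y.
Proof. by rewrite -lecR rmorphD -!normE ler_normD. Qed.

Lemma ncB x y : normc (x - y) <= normc x + normc y.
Proof. by rewrite -(ncN y) ncD. Qed.

Lemma nc_eq0 z : (normc z == 0) = (z == 0).
Proof.
apply/eqP/eqP => [/Normc.eq0_normc //|->]; exact: Normc.normc0.
Qed.

Lemma nc_gt0 z : (0 < normc z) = (z != 0).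
Proof. by rewrite lt_neqAle nc_ge0 andbT eq_sym nc_eq0. Qed.

Lemma ncX z n : normc (z ^+ n) = normc z ^+ n.
Proof. by apply: complexI; rewrite -!normE normrX rmorphXn /= -normE. Qed.

Lemma nc_prod n (u : nat -> C) :
  normc (\prod_(j < n) u j) = \prod_(j < n) normc (u j).
Proof. by apply: complexI; rewrite -normE normr_prod rmorph_prod. Qed.

Lemma nc_lt1 z : (`|z| < 1) = (normc z < 1).
Proof. by rewrite -ltcR. Qed.

Lemma Re_le z : `|Re z| <= normc z.
Proof.
case: z => a b /=; rewrite -sqrtr_sqr ler_wsqrtr //.
by rewrite lerDl sqr_ge0.
Qed.

Lemma Im_le z : `|Im z| <= normc z.
Proof.
case: z => a b /=; rewrite -sqrtr_sqr ler_wsqrtr //.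
by rewrite lerDr sqr_ge0.
Qed.

Lemma nc_le z : normc z <= `|Re z| + `|Im z|.
Proof.
rewrite {1}[z]complexE; apply: le_trans (ncD _ _) _.
rewrite Normc.normcM !nc_real lerD2l ler_piMl // /=.
by rewrite expr0n expr1n add0r sqrtr1.
Qed.

Lemma complexReD x y : Re (x + y) = Re x + Re y. Proof. by case: x; case: y. Qed.
Lemma complexImD x y : Im (x + y) = Im x + Im y. Proof. by case: x; case: y. Qed.
Lemma complexReN x : Re (- x) = - Re x. Proof. by case: x. Qed.
Lemma complexImN x : Im (- x) = - Im x. Proof. by case: x. Qed.
Lemma complexReM x y : Re (x * y) = Re x * Re y - Im x * Im y.
Proof. by case: x; case: y. Qed.
Lemma complexImM x y : Im (x * y) = Re x * Im y + Im x * Re y.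
Proof. by case: x; case: y. Qed.
Lemma complexReJ x : Re (conjc x) = Re x. Proof. by case: x. Qed.
Lemma complexImJ x : Im (conjc x) = - Im x. Proof. by case: x. Qed.
Definition ReImE := (complexReD, complexImD, complexReN, complexImN,
  complexReM, complexImM, complexReJ, complexImJ).

Lemma complex_eqP x y : Re x = Re y -> Im x = Im y -> x = y.
Proof. by case: x => a b; case: y => c d /= -> ->. Qed.

Lemma ncJ x : normc (conjc x) = normc x.
Proof.
by apply/eqP; rewrite -(eqrXn2 (n := 2)) ?nc_ge0 // !nc_sq !ReImE sqrrN.
Qed.

Lemma mulcJ x : x * conjc x = (normc x ^+ 2)%:C.
Proof. by apply: complex_eqP; rewrite nc_sq !ReImE /=; ring. Qed.

Lemma nc_le_sq x y : (normc x <= normc y) = (normc x ^+ 2 <= normc y ^+ 2).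
Proof. by rewrite ler_sqr // nnegrE nc_ge0. Qed.

Lemma nc_lt_sq x y : (normc x < normc y) = (normc x ^+ 2 < normc y ^+ 2).
Proof. by rewrite ltr_sqr // nnegrE nc_ge0. Qed.

(** The identity behind the fact that a Moebius map preserves the disc: it
    compares the moduli of its numerator and denominator. *)
Lemma mobius_sq a z : normc (1 - conjc a * z) ^+ 2 - normc (a - z) ^+ 2 =
  (1 - normc a ^+ 2) * (1 - normc z ^+ 2).
Proof. by rewrite !nc_sq !ReImE /=; ring. Qed.

Lemma mobius_den a z : normc a < 1 -> normc z <= 1 -> 1 - conjc a * z != 0.
Proof.
move=> a1 z1; apply/eqP => /subr0_eq e.
have : normc (conjc a * z) = 1 by rewrite -e nc_real normr1.
rewrite Normc.normcM ncJ.
move=> e1; have := nc_ge0 a; have := nc_ge0 z; nra.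
Qed.

Lemma mobius_le1 a z : normc a < 1 -> normc z <= 1 ->
  normc ((a - z) / (1 - conjc a * z)) <= 1.
Proof.
move=> a1 z1; have d0 := mobius_den a1 z1.
rewrite Normc.normcM Normc.normcV ler_pdivrMr ?nc_gt0 // mul1r.
rewrite nc_le_sq -subr_ge0 mobius_sq mulr_ge0 // subr_ge0.
- by rewrite expr_le1 ?nc_ge0 // ltW.
- by rewrite expr_le1 ?nc_ge0.
Qed.

Lemma mobius_lt1 a z : normc a < 1 -> normc z < 1 ->
  normc ((a - z) / (1 - conjc a * z)) < 1.
Proof.
move=> a1 z1; have d0 := mobius_den a1 (ltW z1).
rewrite Normc.normcM Normc.normcV ltr_pdivrMr ?nc_gt0 // mul1r.
rewrite nc_lt_sq -subr_gt0 mobius_sq mulr_gt0 // subr_gt0.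
- by rewrite expr_lt1 ?nc_ge0.
- by rewrite expr_lt1 ?nc_ge0.
Qed.

End Modulus.

(** * Complex differentiability and discs *)

Section Holo.
Variable R : realType.
Local Notation C := R[i].
Local Notation normc := (@Normc.normc R).

(** The copy [C^o] is needed to view the field as a normed module over itself. *)
Definition hol (f : C -> C) (z : C) := derivable (f : C^o -> C^o) z 1.

(** A quadratic bound on the Taylor remainder, rather than a limit, is what
    survives a passage to the limit of infinite products. *)
Lemma hol_quad (f : C -> C) (z D : C) (M r : R) : 0 < r ->
  (forall h, normc h < r ->
     normc (f (z + h) - f z - h * D) <= M * normc h ^+ 2) ->
  hol f z.
Proof.
move=> r0 H; apply/cvg_ex; exists D.
apply/cvgrPdist_le => /= e e0.
have [e' e'0 ee] : exists2 e' : R, 0 < e' & e = e'%:C.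
  exists (Re e); first by move: e0; rewrite ltcE => /andP[].
  by apply: complex_eqP => //=; move: e0; rewrite ltcE => /andP[/eqP].
rewrite {}ee.
have M0 : 0 <= `|M| by [].
pose d := Num.min r (e' / (`|M| + 1)).
have d0 : 0 < d by rewrite lt_min r0 divr_gt0 // ltr_wpDl.
near=> h.
have h0 : h != 0 by near: h; exact: (@nbhs_dnbhs_neq C^o).
have hd : normc h < d.
  rewrite -ltcR -normE; near: h; apply: (@dnbhs0_lt _ C^o).
  by rewrite ltcR.
rewrite normE lecR.
have [hr he] : normc h < r /\ normc h < e' / (`|M| + 1).
  by move: hd; rewrite /d lt_min => /andP[].
have := H _ hr.
rewrite -[_ *: 1]/(h * 1) mulr1 (addrC h z).
have -> : D - (h^-1 *: (f (z + h) - f z) : C^o) =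
  - (h^-1 * (f (z + h) - f z - h * D)) :> C.
  by rewrite -[_ *: _]/(h^-1 * (f (z + h) - f z)); field.
rewrite ncN Normc.normcM Normc.normcV => H1.
rewrite ler_pdivrMl ?nc_gt0 //.
apply: le_trans H1 _.
rewrite expr2 mulrCA ler_wpM2l ?nc_ge0 //.
move: he; rewrite ltr_pdivlMr ?ltr_wpDl // => he.
have := nc_ge0 h; have := ler_norm M; nra.
Unshelve. all: by end_near.
Qed.

Lemma hol_cst (c z : C) : hol (fun=> c) z. Proof. exact: derivable_cst. Qed.
Lemma hol_id z : hol id z. Proof. exact: derivable_id. Qed.
Lemma holD f g z : hol f z -> hol g z -> hol (fun x => f x + g x) z.
Proof. exact: derivableD. Qed.
Lemma holN f z : hol f z -> hol (fun x => - f x) z.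
Proof. exact: derivableN. Qed.
Lemma holB f g z : hol f z -> hol g z -> hol (fun x => f x - g x) z.
Proof. exact: derivableB. Qed.
Lemma holM f g z : hol f z -> hol g z -> hol (fun x => f x * g x) z.
Proof. exact: derivableM. Qed.
Lemma holV f z : f z != 0 -> hol f z -> hol (fun x => (f x)^-1) z.
Proof. exact: derivableV. Qed.

Lemma hol_comp (V : normedModType C) (f : C -> V) (g : C -> C) z :
  hol g z -> derivable (f : C^o -> V) (g z) 1 ->
  derivable ((f \o g) : C^o -> V) z 1.
Proof.
move=> /derivable1_diffP dg /derivable1_diffP df.
apply/derivable1_diffP.
exact: (@differentiable_comp _ C^o C^o V g f z dg df).
Qed.

Lemma holo_disc_comp (V : normedModType C) (Om : set V) (phi : C -> V)
    (g : C -> C) : holo_disc Om phi ->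
  (forall z, normc z < 1 -> normc (g z) < 1 /\ hol g z) ->
  holo_disc Om (phi \o g).
Proof.
move=> Hphi Hg z; rewrite nc_lt1 => /Hg[gz dg].
have [Om1 d1] : Om (phi (g z)) /\ derivable (phi : C^o -> V) (g z) 1.
  by apply: Hphi; rewrite nc_lt1.
split; first exact: Om1.
exact (@hol_comp V phi g z dg d1).
Qed.

Lemma holo_disc_pair (V W : normedModType C) (D : set V) (G : set W)
    (phi : C -> V) (psi : C -> W) : holo_disc D phi -> holo_disc G psi ->
  holo_disc (D `*` G) (fun z => (phi z, psi z)).
Proof.
move=> H1 H2 z z1; have [Dz d1] := H1 z z1; have [Gz d2] := H2 z z1.
split; first by [].
apply/derivable1_diffP.
apply: differentiable_pair; apply/derivable1_diffP; [exact d1|exact d2].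
Qed.

Lemma holo_disc_fst (V W : normedModType C) (D : set V) (G : set W)
    (phi : C -> V * W) : holo_disc (D `*` G) phi -> holo_disc D (fst \o phi).
Proof.
move=> H z z1; have [[Dz _] /cvg_ex[l dl]] := H z z1; split; first exact: Dz.
by apply/cvg_ex; exists l.1; exact (cvg_comp _ _ dl cvg_fst).
Qed.

Lemma holo_disc_snd (V W : normedModType C) (D : set V) (G : set W)
    (phi : C -> V * W) : holo_disc (D `*` G) phi -> holo_disc G (snd \o phi).
Proof.
move=> H z z1; have [[_ Gz] /cvg_ex[l dl]] := H z z1; split; first exact: Gz.
by apply/cvg_ex; exists l.2; exact (cvg_comp _ _ dl cvg_snd).
Qed.

Lemma holo_disc_affine (V : normedModType C) (D : set V) (z u : V) :
  open D -> D z -> u != 0 ->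
  exists2 v : V, v != 0 & holo_disc D (fun x : C => z + x *: v).
Proof.
move=> oD Dz u0.
have /nbhs_ballP[e /= e0 He] : nbhs z D by exact: open_nbhs_nbhs.
have nu0 : `|u| != 0 by rewrite normr_eq0.
have eu0 : e / `|u| != 0 by rewrite mulf_neq0 ?invr_eq0 // gt_eqF.
exists ((e / `|u|) *: u); first by rewrite scaler_eq0 negb_or eu0.
move=> x x1; split.
  apply: He; rewrite -ball_normE /= opprD addrA subrr add0r normrN !normrZ.
  by rewrite normrM normfV normr_id mulfVK // (gtr0_norm e0) gtr_pMl.
apply/derivable1_diffP; apply: differentiableD.
  exact (differentiable_cst _ _).
have di : differentiable (id : C^o -> C^o) (x : C^o).
  by apply/derivable1_diffP; exact: derivable_id.
exact (@differentiableZl C C^o V id _ x di).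
Qed.

End Holo.

#[local] Arguments Normc.normc {R} x : simpl never.

(** * Infinite products and Blaschke products *)

Section ComplexSequences.
Variable R : realType.
Local Notation C := R[i].
Local Notation normc := (@Normc.normc R).

(** Stated with the real-valued modulus, so that all estimates take place in an
    ordered field. *)
Definition cvgC (u : nat -> C) (l : C) :=
  forall e : R, 0 < e -> exists N, forall k, (N <= k)%N -> normc (u k - l) <= e.

Lemma cvgC_bound u l a m N : cvgC u l ->
  (forall k, (N <= k)%N -> normc (u k - a) <= m) -> normc (l - a) <= m.
Proof.
move=> ul um; apply/ler_addgt0Pr => e e0.
have [K HK] := ul e e0.
have h1 := HK (maxn N K) (leq_maxr _ _); have h2 := um (maxn N K) (leq_maxl _ _).
have -> : l - a = (u (maxn N K) - a) - (u (maxn N K) - l) by ring.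
by apply: le_trans (ncB _ _) _; exact: lerD.
Qed.

Lemma cvgCB u v l m : cvgC u l -> cvgC v m ->
  cvgC (fun k => u k - v k) (l - m).
Proof.
move=> ul vm e e0; have e20 : 0 < e / 2 by rewrite divr_gt0.
have [N1 H1] := ul _ e20; have [N2 H2] := vm _ e20.
exists (maxn N1 N2) => k; rewrite geq_max => /andP[/H1 h1 /H2 h2].
have -> : u k - v k - (l - m) = (u k - l) - (v k - m) by ring.
by apply: le_trans (ncB _ _) _; lra.
Qed.

Lemma cvgCMl c u l : cvgC u l -> cvgC (fun k => c * u k) (c * l).
Proof.
move=> ul e e0; have c0 : 0 < normc c + 1 by rewrite ltr_wpDl ?nc_ge0.
have [N H] := ul _ (divr_gt0 e0 c0).
exists N => k /H; rewrite -mulrBr Normc.normcM ler_pdivlMr // => h.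
have := nc_ge0 c; have := nc_ge0 (u k - l); nra.
Qed.

Lemma is_cvg_summable_diff (v d : nat -> R) (c S : R) :
  (forall k, 0 <= d k) -> (forall k, \sum_(j < k) d j <= S) ->
  (forall k, `|v k.+1 - v k| <= c * d k) -> cvgn v.
Proof.
move=> d0 dS vd.
have cd : cvgn (series (fun k => c * d k)).
  have : cvgn (series d).
    apply: nondecreasing_is_cvgn.
      apply/nondecreasing_seqP => n; rewrite /series /=.
      by rewrite big_nat_recr //= lerDl.
    by exists S => _ [n _ <-]; rewrite /series /= big_mkord.
  by move=> cd; apply: is_cvg_seriesZ.
have ct : cvgn (series (telescope v)).
  apply: normed_cvg; apply: series_le_cvg cd => n //=.
  - exact: le_trans (normr_ge0 _) (vd n).
  - exact: vd.
have -> : v = (fun n => v 0%N + series (telescope v) n).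
  by apply/funext => n; rewrite -eq_sum_telescope.
by apply: is_cvgD => //; exact: is_cvg_cst.
Qed.

(** Completeness, reduced to that of the real line by taking real and
    imaginary parts. *)
Lemma cvgC_summable_diff (u : nat -> C) (d : nat -> R) (c S : R) :
  (forall k, 0 <= d k) -> (forall k, \sum_(j < k) d j <= S) ->
  (forall k, normc (u k.+1 - u k) <= c * d k) -> exists l, cvgC u l.
Proof.
move=> d0 dS ud.
have /cvg_ex[/= lr Hr] : cvgn (fun k => Re (u k)).
  apply: (is_cvg_summable_diff d0 dS) => k; apply: le_trans (ud k).
  by apply: le_trans (Re_le _); rewrite complexReD complexReN.
have /cvg_ex[/= li Hi] : cvgn (fun k => Im (u k)).
  apply: (is_cvg_summable_diff d0 dS) => k; apply: le_trans (ud k).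
  by apply: le_trans (Im_le _); rewrite complexImD complexImN.
exists (lr +i* li) => e e0; have e20 : 0 < e / 2 by rewrite divr_gt0.
move/cvgrPdist_le : Hr => /(_ _ e20)[N1 _ H1].
move/cvgrPdist_le : Hi => /(_ _ e20)[N2 _ H2].
exists (maxn N1 N2) => k; rewrite geq_max => /andP[/H1 /= h1 /H2 /= h2].
apply: le_trans (nc_le _) _; rewrite !ReImE /=.
by move: h1 h2; rewrite distrC [X in _ -> X <= _ -> _]distrC; lra.
Qed.

Section Product.
Variables (b : nat -> C -> C) (d : nat -> C) (dl : nat -> R) (S L r : R) (z : C).
Hypotheses (r0 : 0 < r) (L0 : 0 <= L) (dl0 : forall j, 0 <= dl j).
Hypothesis dlS : forall k, \sum_(j < k) dl j <= S.
Hypothesis b1 : forall j h, normc h < r -> normc (b j (z + h)) <= 1.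
Hypothesis bd : forall j h, normc h < r -> normc (b j (z + h) - 1) <= L * dl j.
Hypothesis bL : forall j h, normc h < r ->
  normc (b j (z + h) - b j z) <= L * dl j * normc h.
Hypothesis bq : forall j h, normc h < r ->
  normc (b j (z + h) - b j z - h * d j) <= L * dl j * normc h ^+ 2.
Hypothesis dL : forall j, normc (d j) <= L * dl j.

Local Notation P k x := (\prod_(j < k) b j x).

(** The derivatives at [z] of the partial products, by the Leibniz rule. *)
Fixpoint dprod k : C :=
  if k is k'.+1 then dprod k' * b k' z + P k' z * d k' else 0.

Lemma prod_le1 k h : normc h < r -> normc (P k (z + h)) <= 1.
Proof.
move=> hr; rewrite (nc_prod _ (fun j => b j (z + h))).
by apply: prodr_ile1 => j _; rewrite nc_ge0 b1.
Qed.

Let nc0r : normc 0 < r. Proof. by rewrite Normc.normc0. Qed.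

Lemma prod_le1_0 k : normc (P k z) <= 1.
Proof. by have := prod_le1 k nc0r; rewrite addr0. Qed.

Lemma b1_0 k : normc (b k z) <= 1.
Proof. by have := b1 k nc0r; rewrite addr0. Qed.

Lemma prod_cauchy h : normc h < r -> exists l, cvgC (fun k => P k (z + h)) l.
Proof.
move=> hr; apply: (cvgC_summable_diff (c := L) dl0 dlS) => k.
rewrite big_ord_recr /= -{2}[\prod_(_ < _) _]mulr1 -mulrBr Normc.normcM.
have := prod_le1 k hr; have := bd k hr.
have := nc_ge0 (P k (z + h)); have := nc_ge0 (b k (z + h) - 1); nra.
Qed.

Lemma dprod_le k : normc (dprod k) <= L * \sum_(j < k) dl j.
Proof.
elim: k => [|k IH] /=; first by rewrite big_ord0 mulr0 Normc.normc0.
rewrite big_ord_recr /= mulrDr; apply: le_trans (ncD _ _) _.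
rewrite !Normc.normcM; apply: lerD.
- apply: le_trans IH; rewrite ler_piMr ?nc_ge0 //; exact: b1_0.
- apply: le_trans (dL k); rewrite ler_piMl ?nc_ge0 //; exact: prod_le1_0.
Qed.

Lemma prod_lip k h : normc h < r ->
  normc (P k (z + h) - P k z) <= L * (\sum_(j < k) dl j) * normc h.
Proof.
move=> hr; elim: k => [|k IH].
  by rewrite !big_ord0 mulr0 mul0r subrr Normc.normc0.
rewrite !big_ord_recr /= mulrDr mulrDl.
have -> : P k (z + h) * b k (z + h) - P k z * b k z =
   (P k (z + h) - P k z) * b k (z + h) + P k z * (b k (z + h) - b k z) by ring.
apply: le_trans (ncD _ _) _.
rewrite !Normc.normcM; apply: lerD.
- apply: le_trans IH; rewrite ler_piMr ?nc_ge0 //; exact: b1.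
- apply: le_trans (bL k hr); rewrite ler_piMl ?nc_ge0 //; exact: prod_le1_0.
Qed.

(** Passing from k to k + 1 costs the remainder of the new factor, plus the
    product of the increments of the partial product and of the new factor;
    both are of order [dl k] times the square of [h], so the constant stays
    bounded in k. *)
Lemma prod_quad k h : normc h < r ->
  normc (P k (z + h) - P k z - h * dprod k) <=
    (L + L * L * S) * (\sum_(j < k) dl j) * normc h ^+ 2.
Proof.
move=> hr; elim: k => [|k IH].
  by rewrite !big_ord0 /= !mulr0 mul0r subrr subr0 Normc.normc0.
rewrite !big_ord_recr /= [_ * (_ + dl k)]mulrDr [X in _ <= X]mulrDl.
have -> : P k (z + h) * b k (z + h) - P k z * b k z
    - h * (dprod k * b k z + P k z * d k) =
   (P k (z + h) - P k z - h * dprod k) * b k z +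
   (P k z * (b k (z + h) - b k z - h * d k) +
   (P k (z + h) - P k z) * (b k (z + h) - b k z)) by ring.
apply: le_trans (ncD _ _) _; apply: lerD.
  by rewrite Normc.normcM; apply: le_trans IH; rewrite ler_piMr ?nc_ge0 ?b1_0.
apply: le_trans (ncD _ _) _; rewrite !Normc.normcM mulrDl mulrDl; apply: lerD.
- apply: le_trans (bq k hr); rewrite ler_piMl ?nc_ge0 //; exact: prod_le1_0.
- apply: le_trans (ler_pM _ _ (prod_lip k hr) (bL k hr)) _;
    rewrite ?nc_ge0 //.
  have -> : L * (\sum_(j < k) dl j) * normc h * (L * dl k * normc h) =
    (\sum_(j < k) dl j) * (L * L * dl k * normc h ^+ 2) by ring.
  have -> : L * L * S * dl k * normc h ^+ 2 =
    S * (L * L * dl k * normc h ^+ 2) by ring.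
  by rewrite ler_wpM2r ?mulr_ge0 ?exprn_ge0 ?nc_ge0.
Qed.

(** The remainder bounds of the partial products are uniform and the
    derivatives [dprod] form a Cauchy sequence, so both pass to the limit. *)
Lemma hol_infinite_product (B : C -> C) :
  (forall h, normc h < r -> cvgC (fun k => P k (z + h)) (B (z + h))) ->
  hol B z.
Proof.
move=> HB.
have S0 : 0 <= S by apply: le_trans (dlS 0); rewrite big_ord0.
have [D HD] : exists D, cvgC dprod D.
  apply: (cvgC_summable_diff (c := L * S * L + L) dl0 dlS) => k /=.
  have -> : dprod k * b k z + P k z * d k - dprod k =
    dprod k * (b k z - 1) + P k z * d k by ring.
  apply: le_trans (ncD _ _) _; rewrite !Normc.normcM mulrDl; apply: lerD.
    have := bd k nc0r; rewrite addr0 => hb; rewrite -mulrA.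
    apply: ler_pM => //; rewrite ?nc_ge0 //; apply: le_trans (dprod_le k) _.
    by rewrite ler_wpM2l.
  apply: le_trans (dL k); rewrite ler_piMl ?nc_ge0 //; exact: prod_le1_0.
apply: (@hol_quad _ _ _ D ((L + L * L * S) * S) r r0) => h hr.
have := HB 0 nc0r; rewrite addr0 => HB0.
have := cvgCB (cvgCB (HB h hr) HB0) (cvgCMl h HD).
move=> /(cvgC_bound (a := 0) (N := 0%N)); rewrite subr0; apply => k _.
rewrite subr0; apply: le_trans (prod_quad k hr) _.
rewrite ler_wpM2r ?exprn_ge0 ?nc_ge0 // ler_wpM2l //.
by rewrite addr_ge0 // !mulr_ge0.
Qed.

End Product.

Section Blaschke.
Variables (a : nat -> C) (S : R).
Hypotheses (a0 : forall j, a j != 0) (a1 : forall j, normc (a j) < 1).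
Hypothesis aS : forall k, \sum_(j < k) (1 - normc (a j)) <= S.

(** The unimodular constant makes the value at 0 equal to the modulus of the
    zero, which is what lets the infinite product converge. *)
Definition bfactor j x : C :=
  ((normc (a j))%:C / a j) * ((a j - x) / (1 - conjc (a j) * x)).

Let kap j := (normc (a j))%:C / a j.
Let dl j := 1 - normc (a j).

Let kap1 j : normc (kap j) = 1.
Proof.
rewrite /kap Normc.normcM Normc.normcV nc_real ger0_norm ?nc_ge0 // divff //.
by rewrite nc_eq0.
Qed.

Lemma nc_den_ge (c x : C) e : normc c < 1 -> normc x <= 1 - e -> e <= 1 ->
  e <= normc (1 - conjc c * x).
Proof.
move=> c1 xe e1.
have : normc 1 <= normc (1 - conjc c * x) + normc (conjc c * x).
  by apply: le_trans (ncD _ _); rewrite subrK.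
rewrite Normc.normc1 Normc.normcM ncJ.
have := nc_ge0 x; have := nc_ge0 c; nra.
Qed.

Lemma bfactor_le1 j x : normc x <= 1 -> normc (bfactor j x) <= 1.
Proof.
move=> x1; rewrite /bfactor Normc.normcM -/(kap j) kap1 mul1r.
exact: mobius_le1.
Qed.

(** The deviation from 1 is proportional to the distance from the zero to the
    unit circle; every bound needed on the factor and its increments is read
    off this formula. *)
Lemma bfactorE j x : normc x < 1 ->
  bfactor j x = 1 - (dl j)%:C * ((1 + kap j * x) / (1 - conjc (a j) * x)).
Proof.
move=> x1; have d0 := mobius_den (a1 j) (ltW x1).
have na := mulcJ (a j).
move: (a0 j) d0 na; rewrite /bfactor /kap /dl rmorphB rmorph1 rmorphXn /=.
move: (a j) (normc (a j))%:C (conjc (a j)) => A n J A0 d0 na.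
have eJ : J = n ^+ 2 / A by rewrite -na mulrC mulKf.
have d1 : A - n ^+ 2 * x != 0.
  apply: contra_neq d0 => h; apply: (mulfI A0).
  by rewrite mulr0 -h eJ; field.
by rewrite eJ; field; rewrite A0 d1.
Qed.

Let L e : R := 2 / e ^+ 3.

Let Lge e (e0 : 0 < e) (e1 : e <= 1) : [/\ 2 / e <= L e & 2 / e ^+ 2 <= L e].
Proof.
by split; rewrite /L ler_pM2l // lef_pV2 ?posrE ?exprn_gt0 //;
  rewrite ?(expr2,exprS,expr0); nra.
Qed.

(** On the disc of radius 1 - e the deviations of the factors from 1, their
    Lipschitz constants and their second-order remainders are at most
    [2 / e ^ 3] times the distances from the zeros to the unit circle, which
    are summable. *)
Lemma Blaschke_product : exists B : C -> C,
  [/\ forall z, normc z < 1 -> normc (B z) <= 1 /\ hol B z,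
      forall j, B (a j) = 0 &
      cvgC (fun k => (\prod_(j < k) normc (a j))%:C) (B 0)].
Proof.
have dl0 j : 0 <= dl j by rewrite subr_ge0 ltW.
have den e x j : 0 < e -> e <= 1 -> normc x <= 1 - e ->
    normc (1 - conjc (a j) * x)^-1 <= e^-1.
  move=> e0 e1 xe; have h := nc_den_ge (a1 j) xe e1.
  by rewrite Normc.normcV lef_pV2 ?posrE // (lt_le_trans e0 h).
have dlC j : normc (dl j)%:C = dl j by rewrite nc_real ger0_norm.
have num j x : normc x <= 1 -> normc (1 + kap j * x) <= 2.
  move=> x1; apply: le_trans (ncD _ _) _.
  by rewrite Normc.normc1 Normc.normcM kap1 mul1r; lra.
have kj j : normc (kap j + conjc (a j)) <= 2.
  by apply: le_trans (ncD _ _) _; rewrite kap1 ncJ; have := a1 j; lra.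
have dn0 x j : normc x < 1 -> 1 - conjc (a j) * x != 0.
  by move=> x1; apply: mobius_den => //; apply: ltW.
have near1 e x j : 0 < e -> e <= 1 -> normc x <= 1 - e ->
    normc (bfactor j x - 1) <= L e * dl j.
  move=> e0 e1 xe; rewrite bfactorE; last by lra.
  rewrite addrAC subrr add0r ncN !Normc.normcM dlC mulrC ler_wpM2r //.
  have [+ _] := Lge e0 e1; apply: le_trans.
  by apply: ler_pM; rewrite ?nc_ge0 ?den ?num //; lra.
pose d z j := - ((dl j)%:C * ((kap j + conjc (a j)) / (1 - conjc (a j) * z) ^+ 2)).
have local z : normc z < 1 -> exists r e : R, [/\ 0 < r, 0 < e, e <= 1 &
    forall h, normc h < r -> normc (z + h) <= 1 - e].
  move=> z1; exists ((1 - normc z) / 2), ((1 - normc z) / 2).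
  have := nc_ge0 z; split; try lra.
  by move=> h hr; apply: le_trans (ncD _ _) _; lra.
have [B HB] : exists B : C -> C, forall z, normc z < 1 ->
    cvgC (fun k => \prod_(j < k) bfactor j z) (B z).
  suff /choice[B HB] : forall z, exists y, normc z < 1 ->
    cvgC (fun k => \prod_(j < k) bfactor j z) y by exists B.
  move=> z; have [z1|z1] := boolP (normc z < 1); last by exists 0.
  have [r [e [r0 e0 e1 He]]] := local z z1.
  have h0 : normc 0 < r by rewrite Normc.normc0.
  have bb1 j h : normc h < r -> normc (bfactor j (z + h)) <= 1.
    by move=> /He h1; apply: bfactor_le1; lra.
  have bb2 j h : normc h < r -> normc (bfactor j (z + h) - 1) <= L e * dl j.
    by move=> /He h1; apply: near1.
  have [l] := prod_cauchy dl0 aS bb1 bb2 h0.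
  by rewrite addr0 => Hl; exists l.
exists B; split.
- move=> z z1; split.
    have := HB z z1 => /(cvgC_bound (a := 0) (N := 0%N)); rewrite subr0; apply.
    move=> k _; rewrite subr0 (nc_prod _ (fun j => bfactor j z)).
    by apply: prodr_ile1 => j _; rewrite nc_ge0 bfactor_le1 // ltW.
  have [r [e [r0 e0 e1 He]]] := local z z1.
  have ze : normc z <= 1 - e.
    by have := He 0; rewrite Normc.normc0 addr0; exact.
  have [_ L2] := Lge e0 e1.
  have L0 : 0 <= L e by rewrite divr_ge0 // exprn_ge0 // ltW.
  apply: (@hol_infinite_product (@bfactor) (d z) dl S (L e) r z) => //.
  + by move=> j h /He h1; apply: bfactor_le1; lra.
  + by move=> j h /He h1; apply: near1.
  + move=> j h hr; have h1 := He h hr.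
    rewrite !bfactorE //; last by lra.
    have dz := dn0 z j z1; have dzh : 1 - conjc (a j) * (z + h) != 0 by apply: dn0; lra.
    rewrite [X in normc X](_ : _ = - ((dl j)%:C * h * ((kap j + conjc (a j)) *
      ((1 - conjc (a j) * z)^-1 * (1 - conjc (a j) * (z + h))^-1)))); last first.
      by field; rewrite dz dzh.
    rewrite ncN !Normc.normcM dlC.
    rewrite [X in _ <= X](_ : _ = dl j * normc h * L e); last by ring.
    rewrite ler_wpM2l ?mulr_ge0 ?nc_ge0 //; apply: le_trans L2.
    rewrite expr2 invfM; apply: ler_pM; rewrite ?mulr_ge0 ?nc_ge0 //.
    by apply: ler_pM; rewrite ?nc_ge0 ?den.
  + move=> j h hr; have h1 := He h hr.
    rewrite !bfactorE //; last by lra.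
    have dz := dn0 z j z1; have dzh : 1 - conjc (a j) * (z + h) != 0 by apply: dn0; lra.
    rewrite [X in normc X](_ : _ = - ((dl j)%:C * (h * h) *
      (conjc (a j) * (kap j + conjc (a j)) * ((1 - conjc (a j) * z)^-1 *
      (1 - conjc (a j) * z)^-1 * (1 - conjc (a j) * (z + h))^-1)))); last first.
      by rewrite /d; field; rewrite dz dzh.
    rewrite ncN !Normc.normcM dlC.
    rewrite [X in _ <= X](_ : _ = dl j * (normc h * normc h) * L e); last by ring.
    rewrite ler_wpM2l ?mulr_ge0 ?exprn_ge0 ?nc_ge0 //.
    rewrite /L (exprS e 2) expr2 !invfM [e^-1 * (_ * _)]mulrA.
    apply: ler_pM; rewrite ?mulr_ge0 ?nc_ge0 //.
      rewrite ncJ -[2]mul1r; apply: ler_pM; rewrite ?nc_ge0 //.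
      exact: ltW (a1 j).
    apply: ler_pM; rewrite ?mulr_ge0 ?nc_ge0 ?den //.
    by apply: ler_pM; rewrite ?nc_ge0 ?den.
  + move=> j; rewrite /d ncN !Normc.normcM dlC mulrC ler_wpM2r //.
    apply: le_trans L2; apply: ler_pM; rewrite ?nc_ge0 //.
    rewrite Normc.normcV ncX -exprVn -exprVn -Normc.normcV.
    by rewrite ler_pXn2r ?nnegrE ?nc_ge0 ?invr_ge0 ?den // ltW.
  + by move=> h /He h1; apply: HB; lra.
- move=> j; have := HB (a j) (a1 j).
  move=> /(cvgC_bound (a := 0) (m := 0) (N := j.+1)); rewrite subr0.
  move=> H; apply: Normc.eq0_normc; apply/eqP; rewrite eq_le nc_ge0 andbT.
  apply: H => k jk; rewrite subr0 (bigD1 (Ordinal jk)) //=.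
  by rewrite /bfactor subrr mul0r mulr0 mul0r Normc.normc0.
- have := HB 0; rewrite Normc.normc0 => /(_ ltr01).
  rewrite (_ : (fun _ => _) = (fun k => (\prod_(j < k) normc (a j))%:C)) //.
  apply/funext => k; rewrite rmorph_prod; apply: eq_bigr => j _.
  by rewrite /bfactor mulr0 !subr0 divr1 divfK.
Qed.

End Blaschke.
End ComplexSequences.

(** * The complex exponential and logarithm *)

Section RealBounds.
Variable R : realType.
Implicit Types x y : R.

Lemma expR_quad x : `|x| <= 2^-1 -> `|expR x - 1 - x| <= 2 * x ^+ 2.
Proof.
rewrite ler_norml => /andP[x1 x2].
have h1 := expR_ge1Dx x; have h2 := expR_ge1Dx (- x).
have := expRxMexpNx_1 x; have := expR_gt0 x.
rewrite ger0_norm; last by lra.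
by move=> e0 e1; nra.
Qed.

Lemma expR_le2 x : `|x| <= 2^-1 -> expR x <= 2.
Proof.
rewrite ler_norml => /andP[x1 x2].
have h2 := expR_ge1Dx (- x).
have := expRxMexpNx_1 x; have := expR_gt0 x.
by move=> e0 e1; nra.
Qed.

Lemma sin_mvt y : 0 < y -> exists2 c, 0 < c < y & sin y = cos c * y.
Proof.
move=> y0.
have [|c] := @MVT R sin cos 0 y y0 (fun x _ => is_derive_sin x).
  by apply: continuous_subspaceT; exact: continuous_sin.
rewrite in_itv /= => cy; rewrite sin0 !subr0 => e.
by exists c.
Qed.

Lemma sin_le y : `|sin y| <= `|y|.
Proof.
wlog : y / 0 < y => [H|y0].
  have [/H //|y0|<-] := ltgtP 0 y; last by rewrite sin0.
  by rewrite -normrN -sinN -(normrN y); apply: H; rewrite oppr_gt0.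
have [c _ ->] := sin_mvt y0.
by rewrite normrM ler_piMl // cos_max.
Qed.

Lemma cos_quad y : `|cos y - 1| <= y ^+ 2.
Proof.
have -> : cos y - 1 = - (2 * sin (y / 2) ^+ 2).
  have -> : cos y = cos ((y / 2) *+ 2) by congr cos; rewrite mulr2n; lra.
  by rewrite cos_mulr2n cos2sin2; ring.
rewrite normrN ger0_norm; last by apply: mulr_ge0; rewrite // sqr_ge0.
have : sin (y / 2) ^+ 2 <= (y / 2) ^+ 2.
  rewrite -[leLHS]real_normK ?num_real // -[leRHS]real_normK ?num_real //.
  by rewrite ler_sqr ?nnegrE // sin_le.
by have := sqr_ge0 y; rewrite expr_div_n; lra.
Qed.

Lemma sin_quad y : `|y| <= 1 -> `|sin y - y| <= y ^+ 2.
Proof.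
wlog : y / 0 < y => [H|y0 y1].
  have [/H //|y0|<-] := ltgtP 0 y; last by rewrite sin0 subrr normr0.
  move=> y1; have := H (- y); rewrite oppr_gt0 normrN sinN sqrrN => /(_ y0 y1).
  by rewrite -normrN !opprD !opprK.
have [c /andP[c0 cy] ->] := sin_mvt y0.
have -> : cos c * y - y = (cos c - 1) * y by ring.
have := cos_quad c; move: y1; rewrite normrM (gtr0_norm y0).
by have := normr_ge0 (cos c - 1); move: `|_| => v; nra.
Qed.

End RealBounds.

Section ComplexExp.
Variable R : realType.
Local Notation C := R[i].
Local Notation normc := (@Normc.normc R).

Definition cexp (z : C) : C :=
  (expR (Re z))%:C * (cos (Im z) +i* sin (Im z)).

Lemma cexpD x y : cexp (x + y) = cexp x * cexp y.
Proof.
apply: complex_eqP; rewrite /cexp !ReImE /= expRD cosD sinD; ring.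
Qed.

Lemma nc_cexp z : normc (cexp z) = expR (Re z).
Proof.
rewrite Normc.normcM nc_real ger0_norm ?expR_ge0 //.
by rewrite /Normc.normc cos2Dsin2 sqrtr1 mulr1.
Qed.

Lemma cexp_quad h : normc h <= 2^-1 ->
  normc (cexp h - 1 - h) <= 5 * normc h ^+ 2.
Proof.
move=> h1; apply: le_trans (nc_le _) _; rewrite nc_sq /cexp !ReImE /=.
have := le_trans (Re_le h) h1; have := le_trans (Im_le h) h1.
case: h {h1} => x y /= y1 x1.
have ex := expR_quad x1; have e2 := expR_le2 x1; have e0 := expR_gt0 x.
have cy := cos_quad y.
have sy : `|sin y - y| <= y ^+ 2 by apply: sin_quad; lra.
have -> : expR x * cos y - 0 * sin y - 1 - x =
  (expR x - 1 - x) + expR x * (cos y - 1) by ring.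
have -> : expR x * sin y + 0 * cos y - 0 - y =
  expR x * (sin y - y) + (y * (expR x - 1 - x) + y * x) by ring.
have t1 := ler_normD (expR x - 1 - x) (expR x * (cos y - 1)).
have t2 := ler_normD (expR x * (sin y - y)) (y * (expR x - 1 - x) + y * x).
have t3 := ler_normD (y * (expR x - 1 - x)) (y * x).
move: t1 t2 t3; rewrite !normrM (gtr0_norm e0) => t1 t2 t3.
have b1 : expR x * `|cos y - 1| <= 2 * y ^+ 2 by apply: ler_pM => //; exact: ltW.
have b2 : expR x * `|sin y - y| <= 2 * y ^+ 2 by apply: ler_pM => //; exact: ltW.
have b3 : `|y| * `|expR x - 1 - x| <= 2^-1 * (2 * x ^+ 2) by apply: ler_pM.
have b4 : `|y| * `|x| <= (x ^+ 2 + y ^+ 2) / 2.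
  have := sqr_ge0 (`|x| - `|y|).
  by rewrite -(real_normK (num_real x)) -(real_normK (num_real y)); nra.
have := sqr_ge0 x; have := sqr_ge0 y; lra.
Qed.

Lemma hol_cexp z : hol cexp z.
Proof.
apply: (@hol_quad _ _ _ (cexp z) (normc (cexp z) * 5) 2^-1); first by rewrite invr_gt0.
move=> h hr; have -> : cexp (z + h) - cexp z - h * cexp z =
  cexp z * (cexp h - 1 - h) by rewrite cexpD; ring.
by rewrite Normc.normcM -mulrA ler_wpM2l ?nc_ge0 // cexp_quad // ltW.
Qed.

Lemma hol_cexp_comp f z : hol f z -> hol (fun x => cexp (f x)) z.
Proof.
move=> hf; have hc : hol cexp (f z) := @hol_cexp (f z).
exact (@hol_comp R C^o cexp f z hf hc).
Qed.

(** Half-angle formula for the principal argument: smooth off the half-line of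
    nonpositive reals, which is where the denominator vanishes. *)
Definition carg (u : C) : R := 2 * atan (Im u / (normc u + Re u)).

Lemma cexp_carg u : 0 < normc u + Re u ->
  cexp (ln (normc u) +i* carg u) = u.
Proof.
move=> h; have u0 : 0 < normc u.
  by have := Re_le u; rewrite ler_norml => /andP[_]; lra.
have n2 := nc_sq u.
rewrite /cexp /= lnK ?posrE // /carg.
set x := Im u / _; have -> : 2 * atan x = atan x *+ 2 by rewrite mulr_natl.
rewrite cos_mulr2n sin_mulr2n.
have cA : cos (atan x) ^+ 2 = (1 + x ^+ 2)^-1.
  rewrite cos_atan exprVn sqr_sqrtr //; have := sqr_ge0 x; lra.
have c0 : cos (atan x) != 0.
  by apply/eqP => c0; move: cA; rewrite c0 expr0n /= => /esym/eqP;
     rewrite invr_eq0; have := sqr_ge0 x; lra.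
have -> : sin (atan x) = x * cos (atan x).
  by rewrite -{2}[x]atanK /tan mulfVK.
have -> : cos (atan x) * (x * cos (atan x)) = x * cos (atan x) ^+ 2 by ring.
have b2 : Im u ^+ 2 = normc u ^+ 2 - Re u ^+ 2 by rewrite n2; ring.
have -> : cos (atan x) ^+ 2 = (normc u + Re u) / (2 * normc u).
  rewrite cA /x expr_div_n b2; move: (normc u) (Re u) h u0 => n a h u0; field.
  by rewrite !gt_eqF //=; nra.
rewrite /x; move: (normc u) u0 h => n u0 h.
apply: complex_eqP; rewrite !ReImE /= !mul0r ?subr0 ?addr0 !mulr2n; field;
  by rewrite !gt_eqF.
Qed.

End ComplexExp.

(** * The universal covering of a punctured disc *)

Section Covering.
Variable R : realType.
Local Notation C := R[i].
Local Notation normc := (@Normc.normc R).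

Definition cayley (z : C) : C := (1 + z) / (1 - z).

Lemma Re_cayley_gt0 z : normc z < 1 -> 0 < Re (cayley z).
Proof.
move=> z1; have d0 : 1 - z != 0.
  apply/eqP => /subr0_eq e; move: z1; rewrite -e Normc.normc1 ltxx //.
have n0 : 0 < normc (1 - z) ^+ 2 by rewrite exprn_gt0 // nc_gt0.
have e : cayley z * (normc (1 - z) ^+ 2)%:C = (1 + z) * conjc (1 - z).
  by rewrite -mulcJ /cayley mulrA divfK.
have : Re (cayley z) * normc (1 - z) ^+ 2 = 1 - normc z ^+ 2.
  have -> : Re (cayley z) * normc (1 - z) ^+ 2 =
    Re (cayley z * (normc (1 - z) ^+ 2)%:C) by rewrite complexReM /= mulr0 subr0.
  by rewrite e nc_sq !ReImE /=; ring.
move=> H; rewrite -(pmulr_lgt0 _ n0) H subr_gt0.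
by rewrite expr_lt1 ?nc_ge0.
Qed.

Section Cover.
Variable t : R.
Hypothesis t0 : 0 < t.
Local Notation c := (expR (- t)).

Let c0 : 0 < c. Proof. exact: expR_gt0. Qed.
Let c1 : c < 1. Proof. by rewrite expR_lt1 oppr_lt0. Qed.

(** With [c = exp (- t)], the value of the exponential at the origin, this is a
    covering of the disc punctured at [- c], and it fixes the origin. *)
Definition cover (z : C) : C :=
  (cexp (- (t%:C * cayley z)) - c%:C) / (1 - c%:C * cexp (- (t%:C * cayley z))).

Lemma cover0 : cover 0 = 0.
Proof.
rewrite /cover /cayley addr0 subr0 divr1 mulr1.
have -> : cexp (- t%:C) = c%:C.
  by apply: complex_eqP; rewrite /cexp !ReImE /= oppr0 cos0 sin0; ring.
by rewrite subrr mul0r.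
Qed.

Lemma conjc_real (x : R) : conjc x%:C = x%:C.
Proof. by apply: complex_eqP; rewrite /= ?oppr0. Qed.

Lemma cover_disc z : normc z < 1 -> normc (cover z) < 1 /\ hol cover z.
Proof.
move=> z1.
have nc : normc c%:C < 1 by rewrite nc_real gtr0_norm.
have u1 : normc (cexp (- (t%:C * cayley z))) < 1.
  rewrite nc_cexp; have -> : Re (- (t%:C * cayley z)) = - (t * Re (cayley z)).
    by rewrite complexReN complexReM mul0r subr0.
  by rewrite expR_lt1 oppr_lt0 mulr_gt0 // Re_cayley_gt0.
split.
  by rewrite /cover -opprB mulNr ncN -{2}(conjc_real c); exact: mobius_lt1.
have d0 := mobius_den nc (ltW u1); rewrite conjc_real in d0.
have z0 : 1 - z != 0.
  by apply/eqP => /subr0_eq e; move: z1; rewrite -e Normc.normc1 ltxx.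
have hc : hol (fun x => cexp (- (t%:C * cayley x))) z.
  apply: hol_cexp_comp; apply: holN; apply: holM; first exact: hol_cst.
  apply: holM; first by apply: holD; [exact: hol_cst|exact: hol_id].
  by apply: holV => //; apply: holB; [exact: hol_cst|exact: hol_id].
apply: holM; first by apply: holB; [exact: hc|exact: hol_cst].
apply: holV; first exact: d0.
apply: holB; first exact: hol_cst.
by apply: holM; [exact: hol_cst|exact: hc].
Qed.

(** The preimage under [t * cayley] of the point [X - i Y] of the right
    half-plane. *)
Definition lift_pt (X Y : R) : C := ((X - t) -i* Y) / ((X + t) -i* Y).
Definition lift_sq (X Y : R) : R :=
  ((X - t) ^+ 2 + Y ^+ 2) / ((X + t) ^+ 2 + Y ^+ 2).

Lemma nc_lift X Y : normc (lift_pt X Y) ^+ 2 = lift_sq X Y.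
Proof.
by rewrite /lift_pt Normc.normcM Normc.normcV exprMn exprVn !nc_sq /= !sqrrN.
Qed.

Lemma lift_lt1 X Y : 0 < X -> normc (lift_pt X Y) < 1.
Proof.
move=> X0; rewrite -(@expr_lt1 _ 2) ?nc_ge0 // nc_lift /lift_sq.
have h1 := mulr_gt0 X0 t0; have h2 := sqr_ge0 Y.
have h3 : 0 < (X + t) ^+ 2 by rewrite exprn_gt0 // addr_gt0.
by rewrite ltr_pdivrMr ?mul1r; move: h3; rewrite !expr2; lra.
Qed.

(** The image of [l] under the inverse of the final Moebius map of [cover]: its
    logarithms parametrize the fibre of [cover] over [l]. *)
Definition ucov (l : C) : C := (l + c%:C) / (1 + c%:C * l).

Lemma ucov_den l : normc l < 1 -> 1 + c%:C * l != 0.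
Proof.
move=> l1; have := @mobius_den _ (- c%:C) l; rewrite ncN nc_real gtr0_norm //.
move=> /(_ c1 (ltW l1)).
have -> : conjc (- c%:C) = - c%:C by apply: complex_eqP; rewrite !ReImE /= ?oppr0.
by rewrite mulNr opprK.
Qed.

Lemma cover_lift X Y l : 0 < X -> normc l < 1 ->
  cexp (- X +i* Y) = ucov l -> cover (lift_pt X Y) = l.
Proof.
move=> X0 l1 He.
have d1 := ucov_den l1.
set p := (X + t) -i* Y.
have p0 : p != 0 by rewrite eq_complex /= gt_eqF // addr_gt0.
have t0' : t%:C != 0 by rewrite eq_complex /= gt_eqF.
have e1 : (X - t) -i* Y = p - (t%:C + t%:C).
  by apply: complex_eqP; rewrite !ReImE /=; ring.
have cy : t%:C * cayley (lift_pt X Y) = X -i* Y.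
  have -> : X -i* Y = p - t%:C by apply: complex_eqP; rewrite !ReImE /=; ring.
  rewrite /cayley /lift_pt e1 -/p; field.
  rewrite p0 /= opprB addrC subrK.
  by rewrite -mulr2n mulrn_eq0.
rewrite /cover cy (_ : - (X -i* Y) = - X +i* Y); last first.
  by apply: complex_eqP; rewrite !ReImE /= ?opprK.
have c2 : 1 - c%:C * c%:C != 0.
  rewrite -rmorphM /= -(rmorph1 (real_complex R)) -rmorphB /= eq_complex /=.
  by rewrite negb_and gt_eqF // subr_gt0; have := c0; have := c1; nra.
rewrite He /ucov; field; rewrite d1 /=.
by rewrite [X in X != 0](_ : _ = 1 - c%:C * c%:C) //; ring.
Qed.

Lemma ucov_lt1 l : normc l < 1 -> normc (ucov l) < 1.
Proof.
move=> l1; have := @mobius_lt1 _ (- c%:C) l; rewrite ncN nc_real gtr0_norm //.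
move=> /(_ c1 l1).
have -> : conjc (- c%:C) = - c%:C by apply: complex_eqP; rewrite !ReImE /= ?oppr0.
by rewrite -opprD !mulNr opprK ncN addrC.
Qed.

Definition rnum (l : C) := Re l * (1 + c ^+ 2) + c * (1 + normc l ^+ 2).
Definition inum (l : C) := Im l * (1 - c ^+ 2).
Definition msq (l : C) := normc (1 + c%:C * l) ^+ 2.
Definition psq (l : C) := normc (l + c%:C) ^+ 2.

(** Multiplying numerator and denominator by the conjugate denominator gives
    real and imaginary parts with the positive denominator [msq]. *)
Lemma ucovE l : normc l < 1 -> ucov l = (rnum l / msq l) +i* (inum l / msq l).
Proof.
move=> l1; have d0 := ucov_den l1.
have m0 : msq l != 0 by rewrite /msq expf_neq0 // nc_eq0.
have mC : (msq l)%:C != 0 by rewrite eq_complex /= negb_and m0.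
have e : ucov l * (msq l)%:C = rnum l +i* inum l.
  rewrite /ucov /msq -mulcJ mulrA divfK //.
  by apply: complex_eqP; rewrite /rnum /inum nc_sq !ReImE /=; ring.
apply: (mulIf mC); rewrite e; move: (rnum l) (inum l) (msq l) m0 => x y m m0.
by apply: complex_eqP; rewrite (complexReM, complexImM) /= mulr0 ?subr0 ?add0r divfK.
Qed.

(** The negative half-line without 0 is removed.  This is not the cut of the
    logarithm itself: [ucov] moves 0 to the positive real [c]. *)
Definition offslit (l : C) := (Im l != 0) || (0 <= Re l).

Lemma ucov_slit l : normc l < 1 -> offslit l -> 0 < normc (ucov l) + Re (ucov l).
Proof.
move=> l1 sl; have m0 : 0 < msq l by rewrite /msq exprn_gt0 // nc_gt0 ucov_den.
have nu := nc_sq (ucov l); have := nc_ge0 (ucov l).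
move: nu; rewrite (ucovE l1) /=; set n := normc _.
case/orP: sl => [i0|r0] nu n0.
- have : inum l / msq l != 0.
    apply: mulf_neq0; last by rewrite invr_eq0 gt_eqF.
    apply: mulf_neq0 => //; rewrite gt_eqF // subr_gt0.
    by rewrite expr_lt1 ?c1 // ltW // c0.
  move: (inum l / _) (rnum l / _) nu => y x nu y0.
  have y2 : 0 < y ^+ 2 by rewrite lt_neqAle eq_sym sqrf_eq0 y0 sqr_ge0.
  by rewrite ltNge; apply/negP => h; nra.
- suff : 0 < rnum l / msq l by lra.
  rewrite divr_gt0 // ltr_wpDl ?mulr_ge0 ?addr_ge0 ?sqr_ge0 //.
  by rewrite mulr_gt0 // ltr_wpDr ?sqr_ge0.
Qed.

Lemma lift_ge X Y e : 0 < X -> 0 < e -> 1 <= Y -> 4 * t * X / e <= Y ->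
  1 - e <= normc (lift_pt X Y).
Proof.
move=> X0 e0 Y1 Ye.
have n1 := lift_lt1 Y X0; have n0 := nc_ge0 (lift_pt X Y).
suff : 1 - e <= lift_sq X Y by rewrite -nc_lift; nra.
rewrite ler_pdivrMr // in Ye.
have h3 : 0 < (X + t) ^+ 2 by rewrite exprn_gt0 // addr_gt0.
have h4 : 0 <= e * (X + t) ^+ 2 by rewrite mulr_ge0 // ltW.
have h5 : Y <= Y ^+ 2 by nra.
have h6 : e * Y <= e * Y ^+ 2 by rewrite ler_pM2l.
rewrite /lift_sq ler_pdivlMr; last by have := sqr_ge0 Y; lra.
have -> : (1 - e) * ((X + t) ^+ 2 + Y ^+ 2) =
  (X - t) ^+ 2 + Y ^+ 2 + (4 * t * X - e * Y ^+ 2 - e * (X + t) ^+ 2) by ring.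
by lra.
Qed.

Lemma cexpD2pi x y k : cexp (x +i* (y + (pi *+ 2) *+ k)) = cexp (x +i* y) :> C.
Proof.
by rewrite /cexp /= (periodicn (@cosD2pi R)) (periodicn (@sinD2pi R)).
Qed.

(** Adding multiples of 2 pi to the argument runs through the fibre, and the
    fibre points converge to the boundary point 1. *)
Lemma cover_near_boundary l e : normc l < 1 -> offslit l -> 0 < e ->
  exists2 x, normc x < 1 /\ cover x = l & 1 - e <= normc x.
Proof.
move=> l1 sl e0; have us := ucov_slit l1 sl.
have u0 : 0 < normc (ucov l).
  by have := Re_le (ucov l); rewrite ler_norml => /andP[_]; lra.
pose X := - ln (normc (ucov l)).
have X0 : 0 < X by rewrite oppr_gt0 ln_lt0 // u0 ucov_lt1.
have D0 : 0 <= 4 * t * X / e by rewrite !mulr_ge0 ?invr_ge0 // ltW.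
pose A := `|carg (ucov l)| + 1 + 4 * t * X / e.
have [k Hk] : exists k : nat, A <= k%:R.
  by exists (Num.bound A); rewrite ltW // archi_boundP // !addr_ge0.
pose Y := carg (ucov l) + (pi *+ 2) *+ k.
have YA : 1 + 4 * t * X / e <= Y.
  have : k%:R <= (pi *+ 2) *+ k :> R.
    rewrite -[leRHS]mulr_natr ler_peMl //; have := pi_ge2 R; lra.
  have := ler_norm (- carg (ucov l)); rewrite normrN.
  by move: Hk; rewrite /A /Y; lra.
exists (lift_pt X Y).
- split; first exact: lift_lt1.
  by apply: cover_lift => //; rewrite cexpD2pi opprK cexp_carg.
- by apply: lift_ge => //; lra.
Qed.

End Cover.
End Covering.

(** * The principal branch as the parameter varies *)

Section DeriveLambda.
Variable R : realType.
Implicit Types (f g : R -> R) (t a b : R).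

(** Pointwise forms of the differentiation rules: terms built from them match
    the explicit formulas below by unification. *)
Lemma is_deriveD_fun f g t a b : is_derive t 1 f a -> is_derive t 1 g b ->
  is_derive t 1 (fun x => f x + g x) (a + b).
Proof. by move=> hf hg; exact (is_deriveD hf hg). Qed.

Lemma is_deriveB_fun f g t a b : is_derive t 1 f a -> is_derive t 1 g b ->
  is_derive t 1 (fun x => f x - g x) (a - b).
Proof. by move=> hf hg; exact (is_deriveB hf hg). Qed.

Lemma is_deriveM_fun f g t a b : is_derive t 1 f a -> is_derive t 1 g b ->
  is_derive t 1 (fun x => f x * g x) (f t * b + g t * a).
Proof. by move=> hf hg; exact (is_deriveM hf hg). Qed.

Lemma is_derive_cst_fun (k : R) t : is_derive t 1 (fun=> k) 0.
Proof. exact (is_derive_cst k t 1). Qed.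

Lemma is_deriveV_fun f t a : f t != 0 -> is_derive t 1 f a ->
  is_derive t 1 (fun x => (f x)^-1) (- (f t) ^- 2 * a).
Proof. by move=> h hf; exact (is_deriveV h hf). Qed.

Lemma is_derive_comp_fun f g t a b : is_derive (g t) 1 f a -> is_derive t 1 g b ->
  is_derive t 1 (fun x => f (g x)) (a * b).
Proof. by move=> hf hg; exact (is_derive1_comp hf hg). Qed.

Lemma derive_cont f t a : is_derive t 1 f a -> f x @[x --> t] --> f t.
Proof.
move=> [/derivable1_diffP/differentiable_continuous h _]; exact: h.
Qed.

(** At t = 0 the fibre point degenerates to 0 / 0, and its limit is found from
    derivatives. *)
Lemma derive_ratio0 f a : f 0 = 0 -> is_derive (0 : R) 1 f a ->
  f x / x @[x --> 0^'+] --> a.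
Proof.
move=> f0 [df <-].
have := cvg_dnbhs_at_right df.
apply: cvg_trans; apply: near_eq_cvg; near=> x.
by rewrite /= f0 subr0 addr0 [x%:A]mulr1 -[LHS]/(x^-1 * f x) mulrC.
Unshelve. all: by end_near. Qed.

End DeriveLambda.

Section Sheet.
Variable R : realType.
Local Notation C := R[i].
Local Notation normc := (@Normc.normc R).
Implicit Types (a b t : R) (l : C).

(** The squared modulus of the point over [l] given by the principal branch.
    The square keeps it rational in the logarithm and the argument. *)
Definition sheet l t := lift_sq t (- ln (normc (ucov t l))) (carg (ucov t l)).

(** Up to [Yf], explicit functions of t attached to [l = a + i b], meaningful at
    t = 0 too: [pf] and [mf] are the squared moduli of the numerator and the
    denominator of [ucov]; [rf / mf] and [jf / mf] are its real and imaginary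
    parts; [wf / mf] is the denominator in [carg]; finally [Xf] is minus the
    logarithm of the modulus of [ucov] and [Yf] is its argument. *)
Definition cf t : R := expR (- t).
Definition pf a b t := (a + cf t) ^+ 2 + b ^+ 2.
Definition mf a b t := (1 + cf t * a) ^+ 2 + (cf t * b) ^+ 2.
Definition rf a b t := a * (1 + cf t ^+ 2) + cf t * (1 + (a ^+ 2 + b ^+ 2)).
Definition jf a b t := b * (1 - cf t ^+ 2).
Definition wf a b t := Num.sqrt (pf a b t * mf a b t) + rf a b t.
Definition Xf a b t := (ln (mf a b t) - ln (pf a b t)) / 2.
Definition Yf a b t := 2 * atan (jf a b t / wf a b t).

Lemma sheetE l t : 0 < t -> normc l < 1 -> offslit l ->
  [/\ 0 < pf (Re l) (Im l) t, 0 < mf (Re l) (Im l) t, 0 < wf (Re l) (Im l) t,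
      - ln (normc (ucov t l)) = Xf (Re l) (Im l) t &
      carg (ucov t l) = Yf (Re l) (Im l) t].
Proof.
move=> t0 l1 sl; have us := ucov_slit t0 l1 sl.
have u0 : 0 < normc (ucov t l).
  by have := Re_le (ucov t l); rewrite ler_norml => /andP[_]; lra.
have d0 := ucov_den t0 l1.
have m0 : 0 < normc (1 + (expR (- t))%:C * l) by rewrite nc_gt0.
have n0 : 0 < normc (l + (expR (- t))%:C).
  rewrite nc_gt0; apply: contraTneq u0 => e.
  by rewrite /ucov e mul0r Normc.normc0 ltxx.
have pE : psq t l = pf (Re l) (Im l) t.
  by rewrite /psq /pf /cf nc_sq !ReImE /= addr0.
have mE : msq t l = mf (Re l) (Im l) t.
  by rewrite /msq /mf /cf nc_sq !ReImE /=; ring.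
have rE : rnum t l = rf (Re l) (Im l) t by rewrite /rnum /rf /cf nc_sq.
have jE : inum t l = jf (Re l) (Im l) t by [].
have p1 : 0 < pf (Re l) (Im l) t by rewrite -pE exprn_gt0.
have m1 : 0 < mf (Re l) (Im l) t by rewrite -mE exprn_gt0.
have nE : normc (ucov t l) = normc (l + (expR (- t))%:C) / normc (1 + (expR (- t))%:C * l).
  by rewrite /ucov Normc.normcM Normc.normcV.
have sE : Num.sqrt (pf (Re l) (Im l) t * mf (Re l) (Im l) t) =
    normc (ucov t l) * mf (Re l) (Im l) t.
  rewrite -pE -mE /psq /msq -exprMn sqrtr_sqr ger0_norm ?mulr_ge0 ?nc_ge0 //.
  by rewrite nE; field; rewrite gt_eqF.
have ru : Re (ucov t l) = rf (Re l) (Im l) t / mf (Re l) (Im l) t.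
  by rewrite (ucovE t0 l1) /= rE mE.
have iu : Im (ucov t l) = jf (Re l) (Im l) t / mf (Re l) (Im l) t.
  by rewrite (ucovE t0 l1) /= jE mE.
have wE : wf (Re l) (Im l) t = (normc (ucov t l) + Re (ucov t l)) * mf (Re l) (Im l) t.
  by rewrite /wf sE ru mulrDl divfK // gt_eqF.
split=> //.
- by rewrite wE mulr_gt0.
- rewrite nE ln_div ?posrE // /Xf -pE -mE /psq /msq !lnXn //.
  by move: (ln _) (ln _) => x y; field.
- rewrite /carg /Yf wE iu; congr (2 * atan _).
  move: (mf _ _ _) m1 (jf _ _ _) (_ + _) us => m m1 j w w0.
  by field; rewrite !gt_eqF.
Qed.

(** After dividing by t only the ratios [Xf / t] and [Yf / t] matter, and these
    have limits both at 0 and at infinity. *)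
Lemma sheet_scale l t : 0 < t -> normc l < 1 -> offslit l ->
  sheet l t = lift_sq 1 (Xf (Re l) (Im l) t / t) (Yf (Re l) (Im l) t / t).
Proof.
move=> t0 l1 sl; have [_ _ _ EX EY] := sheetE t0 l1 sl.
have X0 : 0 < Xf (Re l) (Im l) t.
  rewrite -EX oppr_gt0 ln_lt0 // ucov_lt1 // andbT.
  have us := ucov_slit t0 l1 sl.
  by have := Re_le (ucov t l); rewrite ler_norml => /andP[_]; lra.
rewrite /sheet EX EY /lift_sq; move: (Xf _ _ _) X0 (Yf _ _ _) => X X0 Y.
have h : 0 < (X + t) ^+ 2 by rewrite exprn_gt0 // addr_gt0.
have h2 := sqr_ge0 Y.
field; rewrite !gt_eqF //=.
by lra.
Qed.

Lemma lift_sq_cvg (F : set_system R) (FF : Filter F) (X Y : R -> R) (x y : R) :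
  X @ F --> x -> Y @ F --> y -> 0 <= x ->
  (fun t => lift_sq 1 (X t) (Y t)) @ F --> lift_sq 1 x y.
Proof.
move=> hX hY x0.
have hX1 : (fun t => (X t - 1) ^+ 2 + Y t ^+ 2) @ F --> (x - 1) ^+ 2 + y ^+ 2.
  by apply: cvgD; rewrite !expr2; apply: cvgM => //; apply: cvgB => //; exact: cvg_cst.
have hX2 : (fun t => (X t + 1) ^+ 2 + Y t ^+ 2) @ F --> (x + 1) ^+ 2 + y ^+ 2.
  by apply: cvgD; rewrite !expr2; apply: cvgM => //; apply: cvgD => //; exact: cvg_cst.
apply: cvgM => //; apply: cvgV => //.
by rewrite gt_eqF // ltr_wpDr ?sqr_ge0 // exprn_gt0 // ltr_wpDl.
Qed.

Definition dpf a b t := 2 * (a + cf t) * - cf t.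
Definition dmf a b t := (2 * (1 + cf t * a) * a + 2 * cf t * b ^+ 2) * - cf t.
Definition drf a b t := (2 * a * cf t + (1 + (a ^+ 2 + b ^+ 2))) * - cf t.
Definition djf a b t := 2 * b * cf t ^+ 2.
Definition dwf a b t :=
  (2 * Num.sqrt (pf a b t * mf a b t))^-1 *
    (pf a b t * dmf a b t + mf a b t * dpf a b t) + drf a b t.

Lemma is_derive_cf t : is_derive t 1 cf (- cf t).
Proof.
have h := @is_derive_comp_fun R expR (fun x => - x) t _ _
  (is_derive_expR (- t)) (is_deriveN (is_derive_id t 1)).
by apply: (@is_derive_eq _ _ _ _ _ _ _ _ h); rewrite mulrN1.
Qed.

Lemma is_derive_sqr_fun f t a : is_derive t 1 f a ->
  is_derive t 1 (fun x => f x ^+ 2) (2 * f t * a).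
Proof.
move=> hf; have h := is_deriveM_fun hf hf.
by apply: is_derive_eq h _; ring.
Qed.

Lemma is_derive_pf a b t : is_derive t 1 (pf a b) (dpf a b t).
Proof.
have h := is_deriveD_fun
  (is_derive_sqr_fun (is_deriveD_fun (is_derive_cst_fun a t) (is_derive_cf t)))
  (is_derive_cst_fun (b ^+ 2) t).
by apply: (@is_derive_eq _ _ _ _ _ _ _ _ h); rewrite /dpf; ring.
Qed.

Lemma is_derive_mf a b t : is_derive t 1 (mf a b) (dmf a b t).
Proof.
have h := is_deriveD_fun
  (is_derive_sqr_fun (is_deriveD_fun (is_derive_cst_fun 1 t)
    (is_deriveM_fun (is_derive_cf t) (is_derive_cst_fun a t))))
  (is_derive_sqr_fun (is_deriveM_fun (is_derive_cf t) (is_derive_cst_fun b t))).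
by apply: (@is_derive_eq _ _ _ _ _ _ _ _ h); rewrite /dmf; ring.
Qed.

Lemma is_derive_rf a b t : is_derive t 1 (rf a b) (drf a b t).
Proof.
have h := is_deriveD_fun
  (is_deriveM_fun (is_derive_cst_fun a t)
    (is_deriveD_fun (is_derive_cst_fun 1 t) (is_derive_sqr_fun (is_derive_cf t))))
  (is_deriveM_fun (is_derive_cf t) (is_derive_cst_fun (1 + (a ^+ 2 + b ^+ 2)) t)).
by apply: (@is_derive_eq _ _ _ _ _ _ _ _ h); rewrite /drf; ring.
Qed.

Lemma is_derive_jf a b t : is_derive t 1 (jf a b) (djf a b t).
Proof.
have h := is_deriveM_fun (is_derive_cst_fun b t)
  (is_deriveB_fun (is_derive_cst_fun 1 t) (is_derive_sqr_fun (is_derive_cf t))).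
by apply: (@is_derive_eq _ _ _ _ _ _ _ _ h); rewrite /djf; ring.
Qed.

Lemma is_derive_wf a b t : 0 < pf a b t -> 0 < mf a b t ->
  is_derive t 1 (wf a b) (dwf a b t).
Proof.
move=> p0 m0; have pm0 : 0 < pf a b t * mf a b t by rewrite mulr_gt0.
have hs := @is_derive_comp_fun R Num.sqrt (fun x => pf a b x * mf a b x) t _ _
  (is_derive1_sqrt pm0) (is_deriveM_fun (is_derive_pf a b t) (is_derive_mf a b t)).
exact (is_deriveD_fun hs (is_derive_rf a b t)).
Qed.

Lemma is_derive_Xf a b t : 0 < pf a b t -> 0 < mf a b t ->
  is_derive t 1 (Xf a b) ((dmf a b t / mf a b t - dpf a b t / pf a b t) / 2).
Proof.
move=> p0 m0.
have hm := @is_derive_comp_fun R (@ln R) (mf a b) t _ _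
  (is_derive1_ln m0) (is_derive_mf a b t).
have hp := @is_derive_comp_fun R (@ln R) (pf a b) t _ _
  (is_derive1_ln p0) (is_derive_pf a b t).
have h := is_deriveM_fun (is_deriveB_fun hm hp) (is_derive_cst_fun 2^-1 t).
by apply: (@is_derive_eq _ _ _ _ _ _ _ _ h); ring.
Qed.

Lemma is_derive_Yf a b t : 0 < pf a b t -> 0 < mf a b t -> 0 < wf a b t ->
  is_derive t 1 (Yf a b) (2 * ((1 + (jf a b t / wf a b t) ^+ 2)^-1 *
    (djf a b t / wf a b t - jf a b t * dwf a b t / wf a b t ^+ 2))).
Proof.
move=> p0 m0 w0; have wn : wf a b t != 0 by rewrite gt_eqF.
have ha := @is_derive_comp_fun R (@atan R) (fun x => jf a b x / wf a b x) t _ _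
  (is_derive1_atan (jf a b t / wf a b t))
  (is_deriveM_fun (is_derive_jf a b t) (is_deriveV_fun wn (is_derive_wf p0 m0))).
have h := is_deriveM_fun (is_derive_cst_fun 2 t) ha.
apply: (@is_derive_eq _ _ _ _ _ _ _ _ h).
by rewrite mulr0 addr0; congr (_ * (_ * _)); ring.
Qed.

Lemma sheet_cont l t : 0 < t -> normc l < 1 -> offslit l ->
  sheet l x @[x --> t] --> sheet l t.
Proof.
move=> t0 l1 sl; have [p0 m0 w0 EX _] := sheetE t0 l1 sl.
have X0 : 0 <= Xf (Re l) (Im l) t.
  by rewrite -EX oppr_ge0 ln_le0 // ltW // ucov_lt1.
have V : x^-1 @[x --> t] --> t^-1.
  by apply: cvgV; [rewrite gt_eqF|exact: cvg_id].
have h : lift_sq 1 (Xf (Re l) (Im l) x / x) (Yf (Re l) (Im l) x / x) @[x --> t]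
    --> lift_sq 1 (Xf (Re l) (Im l) t / t) (Yf (Re l) (Im l) t / t).
  apply: lift_sq_cvg; last by rewrite divr_ge0 // ltW.
  - by apply: cvgM V; exact: derive_cont (is_derive_Xf p0 m0).
  - by apply: cvgM V; exact: derive_cont (is_derive_Yf p0 m0 w0).
rewrite -(sheet_scale t0 l1 sl) in h.
apply: cvg_trans h; apply: near_eq_cvg; near=> x.
rewrite sheet_scale //; near: x; exact: lt_nbhsr.
Unshelve. all: by end_near. Qed.

(** As t tends to 0, the point [(X - i Y) / t] tends to (1 - l) / (1 + l), the
    derivative at 0, so that the fibre point tends to - l. *)
Lemma sheet_cvg0 l : normc l < 1 -> offslit l ->
  sheet l t @[t --> 0^'+] --> normc l ^+ 2.
Proof.
move=> l1 sl; set a := Re l; set b := Im l.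
have nl : a ^+ 2 + b ^+ 2 < 1 by rewrite -nc_sq expr_lt1 // nc_ge0.
have c1 : cf 0 = 1 by rewrite /cf oppr0 expR0.
pose e := (1 + a) ^+ 2 + b ^+ 2.
have e0 : 0 < e by rewrite /e; have := sqr_ge0 b; nra.
have pE : pf a b 0 = e by rewrite /pf c1 addrC [a + 1]addrC addrC.
have mE : mf a b 0 = e by rewrite /mf c1 !mul1r.
have rE : rf a b 0 = e by rewrite /rf c1 /e; ring.
have jE : jf a b 0 = 0 by rewrite /jf c1; ring.
have SE : Num.sqrt (pf a b 0 * mf a b 0) = e.
  by rewrite pE mE -expr2 sqrtr_sqr gtr0_norm.
have wE : wf a b 0 = 2 * e by rewrite /wf SE rE; ring.
have p0 : 0 < pf a b 0 by rewrite pE.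
have m0 : 0 < mf a b 0 by rewrite mE.
have w0 : 0 < wf a b 0 by rewrite wE mulr_gt0.
have X0 : Xf a b 0 = 0 by rewrite /Xf pE mE subrr mul0r.
have Y0 : Yf a b 0 = 0 by rewrite /Yf jE mul0r atan0 mulr0.
have hX := derive_ratio0 X0 (is_derive_Xf p0 m0).
have hY := derive_ratio0 Y0 (is_derive_Yf p0 m0 w0).
have EX : (dmf a b 0 / mf a b 0 - dpf a b 0 / pf a b 0) / 2 = (1 - (a ^+ 2 + b ^+ 2)) / e.
  by rewrite /dmf /dpf mE pE c1; field; rewrite gt_eqF.
have EY : 2 * ((1 + (jf a b 0 / wf a b 0) ^+ 2)^-1 *
    (djf a b 0 / wf a b 0 - jf a b 0 * dwf a b 0 / wf a b 0 ^+ 2)) = 2 * b / e.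
  by rewrite jE !mul0r subr0 expr0n addr0 invr1 mul1r /djf c1 wE; field; rewrite gt_eqF.
rewrite EX in hX; rewrite EY in hY.
have k0 : 0 <= (1 - (a ^+ 2 + b ^+ 2)) / e by rewrite divr_ge0 ?subr_ge0 // ltW.
have : lift_sq 1 (Xf a b t / t) (Yf a b t / t) @[t --> 0^'+] -->
    lift_sq 1 ((1 - (a ^+ 2 + b ^+ 2)) / e) (2 * b / e).
  exact: lift_sq_cvg.
have -> : lift_sq 1 ((1 - (a ^+ 2 + b ^+ 2)) / e) (2 * b / e) = normc l ^+ 2.
  rewrite nc_sq -/a -/b /lift_sq.
  have -> : (1 - (a ^+ 2 + b ^+ 2)) / e - 1 = - 2 * (a + (a ^+ 2 + b ^+ 2)) / e.
    by rewrite /e; field; rewrite -/e gt_eqF.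
  have -> : (1 - (a ^+ 2 + b ^+ 2)) / e + 1 = 2 * (1 + a) / e.
    by rewrite /e; field; rewrite -/e gt_eqF.
  have eE : (1 + a) ^+ 2 + b ^+ 2 = e by [].
  apply: (canLR (mulfK _)).
    rewrite !expr_div_n -mulrDl mulf_neq0 ?invr_eq0 ?expf_neq0 ?gt_eqF //.
    by rewrite !exprMn -mulrDr eE mulr_gt0.
  by field; rewrite gt_eqF.
apply: cvg_trans; apply: near_eq_cvg; near=> x.
rewrite sheet_scale //; near: x; exact: nbhs_right_gt.
Unshelve. all: by end_near. Qed.

(** The logarithm and the argument stay bounded, whereas the fibre point is
    their image under a Moebius map with parameter t. *)
Lemma sheet_cvgy l : normc l < 1 -> offslit l -> l != 0 ->
  sheet l t @[t --> +oo] --> (1 : R).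
Proof.
move=> l1 sl l0; set a := Re l; set b := Im l.
have n0 : 0 < a ^+ 2 + b ^+ 2 by rewrite -nc_sq exprn_gt0 // nc_gt0.
have hc : cf t @[t --> +oo] --> (0 : R) by exact: cvgr_expR.
have hp : pf a b t @[t --> +oo] --> a ^+ 2 + b ^+ 2.
  have -> : a ^+ 2 + b ^+ 2 = (a + 0) * (a + 0) + b ^+ 2 by rewrite addr0 expr2.
  apply: cvgD; last exact: cvg_cst.
  by apply: cvgM; apply: cvgD hc; exact: cvg_cst.
have hm : mf a b t @[t --> +oo] --> (1 : R).
  rewrite [X in _ --> X](_ : _ = (1 + 0 * a) * (1 + 0 * a) + (0 * b) * (0 * b) :> R); last by ring.
  apply: cvgD.
    by apply: cvgM; (apply: cvgD; [exact: cvg_cst|apply: cvgM hc _; exact: cvg_cst]).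
  by apply: cvgM; (apply: cvgM hc _; exact: cvg_cst).
have hV : t^-1 @[t --> +oo] --> (0 : R).
  by apply/gtr0_cvgV0; [near=> x; near: x; exact: nbhs_pinfty_gt|exact: cvg_id].
have hX : Xf a b t / t @[t --> +oo] --> (ln 1 - ln (a ^+ 2 + b ^+ 2)) / 2 * 0.
  apply: cvgM hV; apply: cvgM; last exact: cvg_cst.
  apply: cvgB.
    by apply: continuous_cvg hm; exact: continuous_ln.
  by apply: continuous_cvg hp; exact: continuous_ln.
have hY : Yf a b t / t @[t --> +oo] --> (0 : R).
  have hu : 2 * pi * t^-1 @[t --> +oo] --> 2 * pi * (0 : R).
    by apply: cvgM hV; exact: cvg_cst.
  rewrite mulr0 in hu.
  have hl : - (2 * pi * t^-1) @[t --> +oo] --> (0 : R) by rewrite -oppr0; exact: cvgN.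
  apply: (squeeze_cvgr _ hl hu); near=> t.
  have t0 : 0 < t by near: t; exact: nbhs_pinfty_gt.
  rewrite -mulNr !ler_pM2r ?invr_gt0 // /Yf.
  have := atan_gtNpi2 (jf a b t / wf a b t).
  have := atan_ltpi2 (jf a b t / wf a b t).
  have := pi_gt0 R; lra.
rewrite mulr0 in hX.
have : lift_sq 1 (Xf a b t / t) (Yf a b t / t) @[t --> +oo] --> (lift_sq 1 0 0 : R).
  exact: lift_sq_cvg.
have -> : lift_sq 1 0 0 = 1 :> R.
  by rewrite /lift_sq sub0r add0r sqrrN expr0n addr0 expr1n divr1.
apply: cvg_trans; apply: near_eq_cvg; near=> x.
rewrite sheet_scale //; near: x; exact: nbhs_pinfty_gt.
Unshelve. all: by end_near. Qed.

Lemma sheet_prod_ivt (l : nat -> C) K (s : R) :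
  (forall j, (j < K)%N -> [/\ normc (l j) < 1, offslit (l j) & l j != 0]) ->
  \prod_(j < K) normc (l j) < s -> s < 1 ->
  exists2 t, 0 < t & \prod_(j < K) sheet (l j) t = s ^+ 2.
Proof.
move=> hl ps s1.
have s0 : 0 < s by apply: le_lt_trans ps; apply: prodr_ge0 => j _; exact: nc_ge0.
pose f t := \prod_(j < K) sheet (l j) t.
have f0 : f t @[t --> 0^'+] --> \prod_(j < K) normc (l j) ^+ 2.
  apply: cvg_big => [|j _]; first exact: mul_continuous.
  by have [? ? _] := hl j (ltn_ord j); exact: sheet_cvg0.
have fy : f t @[t --> +oo] --> \prod_(j < K) (1 : R).
  apply: cvg_big => [|j _]; first exact: mul_continuous.
  by have [? ? ?] := hl j (ltn_ord j); exact: sheet_cvgy.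
have fc t : 0 < t -> f x @[x --> t] --> f t.
  move=> t0; apply: cvg_big => [|j _]; first exact: mul_continuous.
  by have [? ? _] := hl j (ltn_ord j); exact: sheet_cont.
rewrite big1_eq in fy.
have p2 : \prod_(j < K) normc (l j) ^+ 2 < s ^+ 2.
  by rewrite prodrXl ltr_pXn2r ?nnegrE ?(ltW s0) //; apply: prodr_ge0 => j _; exact: nc_ge0.
have [t0 t00 ft0] : exists2 t0, 0 < t0 & f t0 < s ^+ 2.
  near (0 : R)^'+ => t0; exists t0; first by near: t0; exact: nbhs_right_gt.
  by near: t0; exact: (cvgr_lt _ f0).
have s21 : s ^+ 2 < 1 by rewrite expr_lt1 // ltW.
have [t1 t01 ft1] : exists2 t1, t0 < t1 & s ^+ 2 < f t1.
  near (pinfty_nbhs R) => t1; exists t1; first by near: t1; apply: nbhs_pinfty_gt; exact: num_real.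
  by near: t1; exact: (cvgr_gt _ fy).
have [||t] := @IVT R f t0 t1 (s ^+ 2) (ltW t01).
- apply: continuous_in_subspaceT => x /set_mem /=; rewrite in_itv /= => /andP[x0 _].
  by apply: fc; exact: lt_le_trans x0.
- have ft := ltW (lt_trans ft0 ft1).
  by rewrite (min_idPl ft) (max_idPr ft) !ltW.
- rewrite in_itv /= => /andP[tt0 _] e; exists t => //.
  exact: lt_le_trans tt0.
Unshelve. all: by end_near. Qed.

End Sheet.

(** * Interpolation by self-maps of the disc *)

Section Rotation.
Variable R : realType.
Local Notation C := R[i].
Local Notation normc := (@Normc.normc R).

(** Each parameter excludes at most one angle in [[0, pi]], and a countable set
    of angles has Lebesgue measure zero. *)
Lemma rotation_offslit (l : nat -> C) :
  exists2 w : C, normc w = 1 & forall j, offslit (w * l j).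
Proof.
pose w (x : R) : C := cos x +i* sin x.
have w1 x : normc (w x) = 1 by rewrite /w /Normc.normc cos2Dsin2 sqrtr1.
suff [x Hx] : exists x, forall j, offslit (w x * l j) by exists (w x).
apply: contrapT => /forallNP H.
pose bad j : set R := [set x | x \in `[0, pi] /\ ~~ offslit (w x * l j)].
have bad_le1 j x y : bad j x -> bad j y -> x = y.
  have badE u : ~~ offslit (w u * l j) -> w u * l j = - (normc (l j))%:C /\ l j != 0.
    rewrite /offslit negb_or negbK -ltNge => /andP[/eqP i0 r0]; split.
      apply: complex_eqP; last by rewrite i0 /= oppr0.
      have := nc_sq (w u * l j); rewrite i0 expr0n addr0 Normc.normcM w1 mul1r /= => e.
      have : (Re (w u * l j) - normc (l j)) * (Re (w u * l j) + normc (l j)) = 0.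
        by rewrite -subr_sqr -e subrr.
      move/eqP; rewrite mulf_eq0 => /orP[|].
        by have := nc_ge0 (l j); move: r0; lra.
      by rewrite addr_eq0 => /eqP.
    by apply: contraTneq r0 => ->; rewrite mulr0 ltxx.
  move=> [xp /badE[ex l0]] [yp /badE[ey _]].
  apply: cos_inj => //; have /(mulIf l0)/(congr1 (@complex.Re R)) := etrans ex (esym ey).
  by [].
have cb : countable [set` `[0 : R, pi]].
  apply: (@sub_countable _ _ _ (\bigcup_j bad j)).
    apply: subset_card_le => x /= xp.
    have /existsNP[j /negP jx] := H x.
    by exists j.
  apply: bigcup_countable => // j _.
  have [[x bx]|nb] := pselect (exists x, bad j x).
    rewrite (_ : bad j = [set x]); first exact: countable1.
    by apply/seteqP; split=> [y /bad_le1/(_ bx)|_ ->].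
  rewrite (_ : bad j = set0); first exact: countable0.
  by apply/seteqP; split=> // y yb; apply: nb; exists y.
have := countable_lebesgue_measure0 cb.
rewrite lebesgue_measure_itv /= lte_fin pi_gt0 oppr0 adde0 => /eqP.
by rewrite eqe gt_eqF ?pi_gt0.
Qed.

End Rotation.

Section Core.
Variable R : realType.
Local Notation C := R[i].
Local Notation normc := (@Normc.normc R).

(** The exact value s of the product is reached either by the intermediate
    value theorem, with [F] selecting all the poles, or, if some parameter is
    0, by a single pole whose fibre point is explicit. *)
Lemma cover_prescribed (l : nat -> C) K (s : R) :
  (forall j, normc (l j) < 1) -> (forall j, offslit (l j)) ->
  \prod_(j < K) normc (l j) < s -> s < 1 ->
  exists (t : R) (F : pred nat) (x : nat -> C), [/\ 0 < t,
    forall j, (j < K)%N -> F j -> normc (x j) < 1 /\ cover t (x j) = l j &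
    \prod_(j < K | F j) normc (x j) = s].
Proof.
move=> l1 sl ps s1.
have s0 : 0 < s by apply: le_lt_trans ps; apply: prodr_ge0 => j _; exact: nc_ge0.
have [[j0 j0K lj0]|l0] := pselect (exists2 j, (j < K)%N & l j = 0).
- have pi0 := pi_gt0 R.
  have s2 : 0 < s ^- 2 - 1.
    by rewrite subr_gt0 invf_gt1 ?exprn_gt0 // expr_lt1 // ltW.
  (* The fibre point over 0 with argument 2 pi has modulus
     pi / sqrt (t ^ 2 + pi ^ 2), which is s for this t. *)
  pose t := pi * Num.sqrt (s ^- 2 - 1).
  have t0 : 0 < t by rewrite mulr_gt0 // sqrtr_gt0.
  exists t, (pred1 j0), (fun=> lift_pt t t (pi *+ 2)); split=> //.
    move=> j _ /eqP ->; rewrite lj0; split; first exact: lift_lt1.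
    apply: cover_lift => //; first by rewrite Normc.normc0.
    rewrite /ucov mulr0 addr0 add0r divr1 /cexp /= cos2pi sin2pi.
    by rewrite -[LHS]/(_ * 1) mulr1.
  rewrite (bigD1 (Ordinal j0K)) //= big1 ?mulr1; last first.
    by move=> i /andP[/eqP ij /eqP ni]; case: ni; exact: val_inj.
  apply/eqP; rewrite -(eqrXn2 (n := 2)) ?nc_ge0 ?(ltW s0) //; apply/eqP.
  rewrite nc_lift /lift_sq subrr expr0n add0r.
  have t2 : t ^+ 2 = pi ^+ 2 * (s ^- 2 - 1) by rewrite exprMn sqr_sqrtr // ltW.
  have -> : (t + t) ^+ 2 = 4 * t ^+ 2 by ring.
  have E (p : R) : 0 < p ->
      (p *+ 2) ^+ 2 / (4 * (p ^+ 2 * (s ^- 2 - 1)) + (p *+ 2) ^+ 2) = s ^+ 2.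
    move=> p0; have -> : 4 * (p ^+ 2 * (s ^- 2 - 1)) + (p *+ 2) ^+ 2 =
      4 * p ^+ 2 / s ^+ 2 by field; rewrite gt_eqF.
    by field; rewrite !gt_eqF.
  by rewrite t2 E.
- have hl j : (j < K)%N -> [/\ normc (l j) < 1, offslit (l j) & l j != 0].
    by move=> jK; split=> //; apply/eqP => e; apply: l0; exists j.
  have [t t0 pt] := sheet_prod_ivt hl ps s1.
  exists t, predT, (fun j => lift_pt t (- ln (normc (ucov t (l j)))) (carg (ucov t (l j)))).
  have us j := ucov_slit t0 (l1 j) (sl j).
  have u0 j : 0 < normc (ucov t (l j)).
    by have := us j; have := Re_le (ucov t (l j)); rewrite ler_norml => /andP[_]; lra.
  split=> //.
    move=> j jK _.
    have X0 : 0 < - ln (normc (ucov t (l j))) by rewrite oppr_gt0 ln_lt0 // u0 ucov_lt1.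
    split; first exact: lift_lt1.
    by apply: cover_lift => //; rewrite opprK cexp_carg.
  apply/eqP; rewrite -(eqrXn2 (n := 2)) ?(ltW s0) //; last first.
    by apply: prodr_ge0 => j _; exact: nc_ge0.
  by rewrite -prodrXl -pt; apply/eqP/eq_bigr => j _; rewrite nc_lift.
Qed.

Lemma prod_ge_1Bsum (I : finType) (P : pred I) (a d : I -> R) :
  (forall j, P j -> 0 <= a j <= 1) -> (forall j, P j -> 1 - d j <= a j) ->
  1 - \sum_(j | P j) d j <= \prod_(j | P j) a j.
Proof.
move=> a1 ad.
suff : 1 - \sum_(j | P j) d j <= \prod_(j | P j) a j /\ 0 <= \prod_(j | P j) a j <= 1 by case.
elim/big_rec2: _ => [|j x y Pj [IH /andP[x0 x1]]]; first by rewrite subr0 !lexx ler01.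
have /andP[aj0 aj1] := a1 j Pj; have adj := ad j Pj.
split; last by rewrite mulr_ge0 //= mulr_ile1.
by nra.
Qed.

Lemma geo_sum (e : R) k : 0 <= e -> \sum_(j < k) e * 2^-1 ^+ j.+1 <= e.
Proof.
move=> e0; rewrite -mulr_sumr ler_piMr //.
suff -> : \sum_(j < k) (2^-1 : R) ^+ j.+1 = 1 - 2^-1 ^+ k.
  by rewrite lerBlDr lerDl exprn_ge0 // invr_ge0.
elim: k => [|k IH]; first by rewrite big_ord0 expr0 subrr.
by rewrite big_ord_recr /= IH exprS; field.
Qed.

Lemma cvgC_real (u : nat -> R) (L : C) (a b : R) K :
  cvgC (fun k => (u k)%:C) L -> (forall k, (K <= k)%N -> a <= u k <= b) ->
  L = (Re L)%:C /\ a <= Re L <= b.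
Proof.
move=> cu ub.
have key e : 0 < e -> [/\ `|Im L| <= e, a - e <= Re L & Re L <= b + e].
  move=> e0; have [N HN] := cu e e0.
  have h := HN _ (leq_maxl N K); have /andP[h1 h2] := ub _ (leq_maxr N K).
  have := le_trans (Re_le _) h; have := le_trans (Im_le _) h.
  rewrite !ReImE /= sub0r normrN => hi; rewrite ler_norml => /andP[h3 h4].
  by split=> //; lra.
have i0 : Im L = 0.
  by apply/normr0_eq0/eqP; rewrite eq_le normr_ge0 andbT; apply/ler_addgt0Pr => e e0;
    rewrite add0r; have [] := key e e0.
split; first by apply: complex_eqP; rewrite //= i0.
apply/andP; split; apply/ler_addgt0Pr => e e0; have [_] := key e e0; lra.
Qed.

(** The parameters not selected by [F] are sent to the points of the fibre at
    distance at most [e / 2 ^ (j + 1)] from the unit circle, with e so small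
    that the product of all the moduli exceeds [normc mu]. *)
Lemma disc_interpolation (l : nat -> C) K (s : R) (mu : C) :
  (forall j, normc (l j) < 1) -> \prod_(j < K) normc (l j) < s -> s < 1 ->
  normc mu < s ->
  exists (x : nat -> C) (g f : C -> C),
    [/\ (forall z, normc z < 1 -> normc (g z) < 1 /\ hol g z) /\ g 0 = 0,
        (forall z, normc z < 1 -> normc (f z) < 1 /\ hol f z) /\ f 0 = 0,
        forall j, normc (x j) < 1,
        forall j, g (x j) = l j /\ f (x j) = mu &
        forall k, (K <= k)%N -> \prod_(j < k) normc (x j) <= s].
Proof.
move=> l1 ps s1 mus.
have mu0 := nc_ge0 mu; have s0 : 0 < s by exact: le_lt_trans mus.
have [w w1 sl] := rotation_offslit l.
have wl1 j : normc (w * l j) < 1 by rewrite Normc.normcM w1 mul1r.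
have pws : \prod_(j < K) normc (w * l j) < s.
  by under eq_bigr do rewrite Normc.normcM w1 mul1r.
have [t [F [y [t0 Hy yF]]]] := cover_prescribed wl1 sl pws s1.
(* This choice makes s (1 - e) the midpoint of normc mu and s. *)
pose e := (s - normc mu) / (2 * s).
have e0 : 0 < e by rewrite divr_gt0 ?subr_gt0 // mulr_gt0.
have se : s * (1 - e) = (s + normc mu) / 2 by rewrite /e; field; rewrite gt_eqF.
have e1 : e < 1.
  have : 0 < s * (1 - e) by rewrite se; lra.
  by rewrite pmulr_rgt0 // subr_gt0.
pose d j : R := e * 2^-1 ^+ j.+1.
have d0 j : 0 < d j by rewrite mulr_gt0 // exprn_gt0 // invr_gt0.
have dle j : d j <= e.
  by rewrite ler_piMr ?(ltW e0) // exprn_ile1 // ?invr_ge0 // invf_le1 // ler1n.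
pose F' j := (j < K)%N && F j.
have /choice[x Hx] : forall j, exists x, [/\ normc x < 1, cover t x = w * l j &
    if F' j then x = y j else 1 - d j <= normc x].
  move=> j; case E: (F' j); first have /andP[jK Fj] := E.
    by exists (y j); have [] := Hy j jK Fj.
  have [x [x1 cx] xd] := cover_near_boundary t0 (wl1 j) (sl j) (d0 j).
  by exists x.
have x1 j : normc (x j) < 1 by have [] := Hx j.
have x01 j : 0 <= normc (x j) <= 1 by rewrite nc_ge0 ltW.
have xNF j : ~~ F' j -> 1 - d j <= normc (x j).
  by have [_ _] := Hx j; case: (F' j).
have prodF k : (K <= k)%N -> \prod_(j < k | F' j) normc (x j) = s.
  move=> Kk; rewrite -yF (big_ord_widen_cond k F (fun j => normc (y j))) //.
  apply: eq_big => j; first by rewrite /F' andbC.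
  by move=> Fj; have [_ _] := Hx j; rewrite Fj => ->.
have prodNF k : 1 - e <= \prod_(j < k | ~~ F' j) normc (x j).
  apply: le_trans (prod_ge_1Bsum (d := fun j : 'I_k => d j) _ _); last 2 first.
  - by move=> j _; exact: x01.
  - by move=> j; exact: xNF.
  rewrite lerD2l lerN2; apply: le_trans (geo_sum k (ltW e0)).
  rewrite [leRHS](bigID (fun j : 'I_k => ~~ F' j)) /= lerDl sumr_ge0 // => j _.
  exact: ltW (d0 j).
have prodE k : (K <= k)%N ->
    \prod_(j < k) normc (x j) = s * \prod_(j < k | ~~ F' j) normc (x j).
  by move=> Kk; rewrite (bigID (fun j : 'I_k => F' j)) /= prodF.
have prod_le k : (K <= k)%N -> \prod_(j < k) normc (x j) <= s.
  by move=> Kk; rewrite prodE // ler_piMr ?(ltW s0) // prodr_ile1.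
have prod_ge k : (K <= k)%N -> s * (1 - e) <= \prod_(j < k) normc (x j).
  by move=> Kk; rewrite prodE // ler_pM2l.
have x0 j : x j != 0.
  rewrite -nc_eq0; have [Fj|/xNF] := boolP (F' j); last first.
    by move=> h; rewrite gt_eqF //; have := dle j; lra.
  have := prodF (maxn K j.+1) (leq_maxl _ _).
  rewrite (bigD1 (Ordinal (leq_maxr K j.+1))) //= => h.
  by apply/eqP => xj; move: s0; rewrite -h xj mul0r ltxx.
have xS k : \sum_(j < k) (1 - normc (x j)) <= K%:R + e.
  apply: (@le_trans _ _ (\sum_(j < k) ((j < K)%N%:R + d j))).
    apply: ler_sum => j _; have [Fj|/xNF] := boolP (F' j).
      by case/andP: Fj => -> _ /=; move: (d0 j) (x01 j) => ? /andP[? ?]; lra.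
    by case: (j < K)%N => /=; lra.
  rewrite big_split /= lerD ?geo_sum ?(ltW e0) //.
  rewrite -natr_sum ler_nat.
  have [kK|Kk] := leqP k K.
    apply: leq_trans kK; rewrite -[X in (_ <= X)%N]card_ord -sum1_card.
    by apply: leq_sum => j _; case: (_ < _)%N.
  rewrite -[X in (_ <= X)%N](card_ord K) -sum1_card (big_ord_widen k (fun=> 1%N)) ?(ltnW Kk) //.
  rewrite [leqRHS]big_mkcond; apply: leq_sum => j _.
  by case: ifP.
have [B [B1 Bx B0]] := Blaschke_product x0 x1 xS.
have bounds k : (K <= k)%N -> s * (1 - e) <= \prod_(j < k) normc (x j) <= s.
  by move=> Kk; rewrite prod_ge ?prod_le.
have [B0E /andP[q1 q2]] := cvgC_real B0 bounds.
move: B0E q1 q2; set q := Re (B 0) => B0E q1 q2.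
have muq : normc mu < q by rewrite se in q1; lra.
have q0 : 0 < q by exact: le_lt_trans muq.
have qC : q%:C != 0 by rewrite eq_complex /= gt_eqF.
have nq : normc q%:C = q by rewrite nc_real gtr0_norm.
have nq1 : normc q%:C < 1 by rewrite nq; lra.
have w0 : w != 0 by rewrite -nc_eq0 w1 oner_eq0.
exists x, (fun z => w^-1 * cover t z),
  (fun z => mu / q%:C * ((q%:C - B z) / (1 - q%:C * B z))).
split; last first.
- exact: prod_le.
- move=> j; have [_ cx _] := Hx j; split; first by rewrite cx mulKf.
  by rewrite Bx mulr0 !subr0 divr1 divfK.
- exact: x1.
- split; last by rewrite B0E subrr mul0r mulr0.
  move=> z z1; have [Bz1 hB] := B1 z z1.
  have den := mobius_den nq1 Bz1; have m1 := mobius_le1 nq1 Bz1.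
  rewrite !conjc_real in den m1.
  split.
    rewrite Normc.normcM; apply: (@le_lt_trans _ _ (normc (mu / q%:C))).
      by rewrite ler_piMr ?nc_ge0.
    by rewrite Normc.normcM Normc.normcV nq ltr_pdivrMr // mul1r.
  apply: holM; first exact: hol_cst.
  apply: holM; first by apply: holB; [exact: hol_cst|exact: hB].
  apply: holV; first exact: den.
  apply: holB; first exact: hol_cst.
  by apply: holM; [exact: hol_cst|exact: hB].
- split; last by rewrite cover0 mulr0.
  move=> z z1; have [c1 hc] := cover_disc t0 z1; split.
    by rewrite Normc.normcM Normc.normcV w1 invr1 mul1r.
  by apply: holM; [exact: hol_cst|exact: hc].
Qed.

End Core.

(** * Enumerations of the poles *)

Section Enumeration.
Variables (R : realType) (V : normedModType R[i]).

Lemma indices_nb_elem_bij (A : set V) : countable A ->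
  exists e : nat -> V, set_bij (indices (nb_elem A)) A e.
Proof.
move=> cA; apply/card_set_bijP; rewrite /nb_elem; case: pselect => [fA|nfA] /=.
  by have /finite_setP[n An] := fA; rewrite (card_fset_set An) card_eq_sym.
by rewrite card_eq_sym; apply/eq_card_nat.
Qed.
End Enumeration.

(** Since [nb_elem] is determined by any enumeration, the poles of a product
    domain can be enumerated along those of one factor. *)
Lemma set_bij_nb_elem (T : pointedType) (A : set T) N (e : nat -> T) :
  set_bij (indices N) A e -> nb_elem A = N.
Proof.
move=> be; have : (indices N #= A)%card by apply/card_set_bijP; exists e.
rewrite card_eq_sym /nb_elem; case: N {be} => [n|] /= An.
  by case: pselect => [fA|[]]; [rewrite (card_fset_set An)|apply/finite_setP; exists n].
case: pselect => // fA; exfalso; apply: infinite_nat.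
by have [n] := (finite_setP _).1 fA; rewrite (card_eql An) => h; apply/finite_setP; exists n.
Qed.

(** * Lempert functions along an enumeration, and the lower bound *)

Section Lempert.
Variable R : realType.
Local Notation C := R[i].
Local Notation normc := (@Normc.normc R).
Implicit Types V W : normedModType C.

(** The parameters are indexed by positions in the enumeration [e] instead of by
    poles, which allows the same parameters to be used for poles in different
    spaces. *)
Definition admissible V (Om : set V) (N : option nat) (e : nat -> V) (x : V)
    (p : R) : Prop :=
  exists (l : nat -> C) (phi : C -> V),
    [/\ forall j, indices N j -> normc (l j) < 1, holo_disc Om phi, phi 0 = x,
        forall j, indices N j -> phi (l j) = e j &
        is_prod N (fun j => normc (l j)) p].

Lemma eq_is_prod N (u v : nat -> R) p : (forall j, indices N j -> u j = v j) ->
  is_prod N u p -> is_prod N v p.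
Proof.
case: N => [n|] /= uv; first by move=> ->; apply: eq_bigr => j _; rewrite uv //= ltn_ord.
by have -> : u = v by apply/funext => j; exact: uv.
Qed.

Lemma lempert_admissible V (Om A : set V) x (e : nat -> V) p :
  set_bij (indices (nb_elem A)) A e -> admissible Om (nb_elem A) e x p ->
  (lempert Om A x <= p%:E)%E.
Proof.
move=> be [l [phi [l1 hphi phi0 phil pr]]].
have [e_fun e_inj e_surj] := be.
(* The inverse of the enumeration, 0 being an arbitrary default off A. *)
pose la a := l (xget 0%N [set j | indices (nb_elem A) j /\ e j = a]).
have laE j : indices (nb_elem A) j -> la (e j) = l j.
  move=> Nj; rewrite /la; case: xgetP => [k _ [Nk ekj]|/(_ j)/=]; last by case.
  by rewrite (e_inj k j (mem_set Nk) (mem_set Nj) ekj).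
apply: ereal_inf_lbound; exists p => //; exists la, phi; split=> //.
- by move=> a /e_surj[j Nj <-]; rewrite laE // nc_lt1; exact: l1.
- by move=> a /e_surj[j Nj <-]; rewrite laE // phil.
- by exists e => //; apply: eq_is_prod pr => j Nj /=; rewrite laE.
Qed.

Lemma lempert_ge V (Om A : set V) x (y : \bar R) :
  (forall e p, set_bij (indices (nb_elem A)) A e ->
     admissible Om (nb_elem A) e x p -> (y <= p%:E)%E) ->
  (y <= lempert Om A x)%E.
Proof.
move=> H; apply: le_ereal_inf_tmp => _ [p [la [phi [l1 hphi phi0 phil [e be pr]]]] <-].
have [e_fun e_inj e_surj] := be.
apply: (H e p be); exists (la \o e), phi; split=> //.
- by move=> j Nj; rewrite -nc_lt1; apply: l1; exact: e_fun.
- by move=> j Nj; apply: phil; exact: e_fun.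
Qed.

Lemma lempert_lt V (Om A : set V) x (y : \bar R) : (lempert Om A x < y)%E ->
  exists e p, [/\ set_bij (indices (nb_elem A)) A e,
    admissible Om (nb_elem A) e x p & (p%:E < y)%E].
Proof.
move=> Hy; apply: contrapT => H; move: Hy; apply/negP; rewrite -leNgt.
apply: lempert_ge => e p be ad; rewrite leNgt; apply/negP => py; apply: H.
by exists e, p.
Qed.

Lemma lempertN_le V (Om : set V) N b x (l : nat -> C) (psi : C -> V) p :
  (forall j, indices N j -> normc (l j) < 1) -> set_inj (indices N) l ->
  holo_disc Om psi -> psi 0 = x -> (forall j, indices N j -> psi (l j) = b) ->
  is_prod N (fun j => normc (l j)) p -> (lempertN Om N b x <= p%:E)%E.
Proof.
move=> l1 li hpsi psi0 psil pr; apply: ereal_inf_lbound; exists p => //.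
exists l, psi; split=> //; split=> // j Nj; rewrite nc_lt1; exact: l1.
Qed.

Lemma lempertN_lt V (Om : set V) N b x (y : \bar R) : (lempertN Om N b x < y)%E ->
  exists (l : nat -> C) (psi : C -> V) p,
   [/\ (forall j, indices N j -> normc (l j) < 1) /\ set_inj (indices N) l,
       holo_disc Om psi, psi 0 = x, (forall j, indices N j -> psi (l j) = b) &
       is_prod N (fun j => normc (l j)) p /\ (p%:E < y)%E].
Proof.
move=> /ereal_inf_lt[_ [p [l [psi [[l1 li] hpsi psi0 psil pr]]] <-] py].
by exists l, psi, p; split=> //; split=> // j Nj; rewrite -nc_lt1; exact: l1.
Qed.

Lemma set_bij_prod1 V W (A : set V) (b : W) N (e : nat -> V) :
  set_bij (indices N) A e ->
  set_bij (indices N) (A `*` [set b]) (fun j => (e j, b)).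
Proof.
move=> [e1 e2 e3]; split.
- by move=> j Nj; split=> //=; exact: e1.
- by move=> i j iN jN [eij]; exact: e2.
- by move=> [a c] /= [/e3[j Nj <-] ->]; exists j.
Qed.

Lemma set_bij_prod1_fst V W (A : set V) (b : W) N (e : nat -> V * W) :
  set_bij (indices N) (A `*` [set b]) e ->
  set_bij (indices N) A (fst \o e) /\ (forall j, indices N j -> (e j).2 = b).
Proof.
move=> [e1 e2 e3].
have eb j : indices N j -> (e j).2 = b by move=> /e1[].
split=> //; split.
- by move=> j /e1[].
- move=> i j iN jN /= eij; apply: e2 => //.
  move: (eb i (set_mem iN)) (eb j (set_mem jN)) eij.
  by case: (e i); case: (e j) => /= ? ? ? ? -> -> ->.
- by move=> a Aa; have [|j Nj ej] := e3 (a, b); [split|exists j; rewrite //= ej].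
Qed.

Lemma nb_elem_prod1 V W (A : set V) (b : W) : countable A ->
  nb_elem (A `*` [set b]) = nb_elem A.
Proof.
move=> cA; have [e be] := indices_nb_elem_bij cA.
exact: (set_bij_nb_elem (set_bij_prod1 b be)).
Qed.

Lemma nb_elem1 V (b : V) : nb_elem [set b] = Some 1%N.
Proof.
apply: (@set_bij_nb_elem _ _ (Some 1%N) (fun=> b)); split.
- by [].
- by move=> [|i] [|j] /set_mem //= _ /set_mem.
- by move=> _ ->; exists 0%N.
Qed.

(** The two projections of a competitor are competitors; the parameters are
    distinct because the first projection separates them. *)
Lemma lempert_prod_ge V W (D : set V) (G : set W) (A : set V) (z : V) (w b : W) :
  countable A ->
  (maxe (lempert D A z) (lempertN G (nb_elem A) b w)
    <= lempert (D `*` G) (A `*` [set b]) (z, w))%E.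
Proof.
move=> cA; apply: lempert_ge => e p; rewrite nb_elem_prod1 // => be.
have [be1 eb] := set_bij_prod1_fst be.
move=> [l [phi [l1 hphi phi0 phil pr]]].
rewrite ge_max; apply/andP; split.
- apply: (lempert_admissible be1); exists l, (fst \o phi); split=> //=.
  + exact: holo_disc_fst hphi.
  + by rewrite phi0.
  + by move=> j Nj; rewrite phil.
- apply: (lempertN_le (l := l) (psi := snd \o phi)) => //=.
  + move=> i j iN jN lij; have [_ einj _] := be.
    by apply: einj => //; rewrite -!phil ?lij //; exact: set_mem.
  + exact: holo_disc_snd hphi.
  + by rewrite phi0.
  + by move=> j Nj; rewrite phil ?eb.
Qed.

End Lempert.

(** * The upper bound *)

Section Upper.
Variable R : realType.
Local Notation C := R[i].
Local Notation normc := (@Normc.normc R).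
Implicit Types V W : normedModType C.

Lemma prod_le_head (u : nat -> R) k : (forall j, (j < k)%N -> 0 <= u j <= 1) ->
  (0 < k)%N -> \prod_(j < k) u j <= u 0%N.
Proof.
case: k => // k u01 _; rewrite big_ord_recl /= ler_piMr //.
  by have /andP[] := u01 0%N isT.
by apply: prodr_ile1 => j _; apply: u01; rewrite /= /bump /= add1n ltnS.
Qed.

Lemma is_prod_lt1 N (u : nat -> R) p : N <> Some 0%N ->
  (forall j, indices N j -> 0 <= u j < 1) -> is_prod N u p -> p < 1.
Proof.
case: N => [n|] /= N0 u01 pr.
- have n0 : (0 < n)%N by rewrite lt0n; apply/eqP => n0; apply: N0; rewrite n0.
  rewrite pr; apply: (le_lt_trans (prod_le_head _ n0)).
    by move=> j jn; have /andP[-> /ltW ->] := u01 j jn.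
  by have /andP[] := u01 0%N n0.
- have /andP[_ u1] := u01 0%N I; apply: le_lt_trans u1.
  apply: (cvgr_to_le pr); near=> k; apply: prod_le_head.
    by move=> j _; have /andP[-> /ltW ->] := u01 j I.
  by near: k; exists 1%N.
Unshelve. all: by end_near. Qed.

Lemma is_prod_partial N (u : nat -> R) p s : is_prod N u p -> p < s ->
  exists2 K, \prod_(j < K) u j < s & N = Some K \/ N = None.
Proof.
case: N => [n|] /= pr ps; first by exists n; [rewrite -pr|left].
have [K _ HK] := cvgr_lt _ pr _ ps.
by exists K; [apply: HK => /=|right].
Qed.

Lemma is_prod_exists N (u : nat -> R) K s : (forall j, 0 <= u j <= 1) ->
  (forall k, (K <= k)%N -> \prod_(j < k) u j <= s) ->
  N = Some K \/ N = None -> exists2 q, is_prod N u q & q <= s.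
Proof.
move=> u01 us [->|->] /=; first by exists (\prod_(j < K) u j) => //; exact: us.
have /cvg_ex[/= q hq] : cvgn (fun k => \prod_(j < k) u j).
  apply: nonincreasing_is_cvgn.
    apply/nonincreasing_seqP => k; rewrite big_ord_recr /= ler_piMr //.
      by apply: prodr_ge0 => j _; have /andP[] := u01 j.
    by have /andP[] := u01 k.
  by exists 0 => _ [k _ <-]; apply: prodr_ge0 => j _; have /andP[] := u01 j.
exists q => //; apply: (cvgr_to_le hq); near=> k; apply: us; near: k.
by exists K.
Unshelve. all: by end_near. Qed.

(** Provides the number s that [disc_interpolation] requires. *)
Lemma real_between (m : R) (L : \bar R) : (m%:E < L)%E -> m < 1 ->
  exists s, [/\ m < s, s < 1 & (s%:E < L)%E].
Proof.
case: L => [r||] //=; last by move=> _ m1; exists ((m + 1) / 2); rewrite ltry; split=> //; lra.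
rewrite lte_fin => mr m1; exists ((m + Num.min r 1) / 2); rewrite lte_fin.
by have [r1|r1] := leP r 1; split; lra.
Qed.

(** The argument is by contradiction, which provides room for the number s
    between the products of the competitors and the alleged larger value. *)
Lemma lempert_prod_le V W (D : set V) (G : set W) (A : set V) (z : V) (w b : W) :
  A !=set0 -> countable A ->
  (lempert (D `*` G) (A `*` [set b]) (z, w)
    <= maxe (lempert D A z) (lempert G [set b] w))%E.
Proof.
move=> [a0 Aa0] cA; rewrite leNgt gt_max; apply/negP => /andP[LD LG].
move: LD LG; set L := lempert _ _ (z, w) => LD LG.
have [e [p [be [l [phi [l1 hphi phi0 phil pr]]] pL]]] := lempert_lt LD.
have [e' [p' [be' [l' [psi [l1' hpsi psi0 psil pr']]] pL']]] := lempert_lt LG.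
rewrite nb_elem1 /= big_ord1 in be' l1' psil pr'.
pose mu := l' 0%N.
have mu1 : normc mu < 1 by exact: l1'.
have psimu : psi mu = b by rewrite psil //; have [+ _ _] := be'; exact.
pose N := nb_elem A; rewrite -/N in be l1 phil pr.
have N0 : N <> Some 0%N.
  by move=> N0; have [_ _ /(_ _ Aa0)[j]] := be; rewrite N0.
have p1 : p < 1.
  by apply: (is_prod_lt1 N0 _ pr) => j Nj; rewrite nc_ge0 l1.
have [s [ms s1 sL]] : exists s, [/\ Num.max p (normc mu) < s, s < 1 & (s%:E < L)%E].
  apply: real_between; last by rewrite gt_max p1.
  by rewrite EFin_max gt_max pL /mu -pr'.
move: ms; rewrite gt_max => /andP[ps mus].
have [K Kps NK] := is_prod_partial pr ps.
(* Beyond N any parameters in the disc will do: K never exceeds N. *)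
pose lt j := if `[< indices N j >] then l j else 0.
have ltE j : indices N j -> lt j = l j by move=> Nj; rewrite /lt asboolT.
have lt1 j : normc (lt j) < 1.
  by rewrite /lt; case: asboolP => [/l1//|_]; rewrite Normc.normc0.
have pK : \prod_(j < K) normc (lt j) < s.
  rewrite (eq_bigr (fun j : 'I_K => normc (l j))) // => j _; rewrite ltE //.
  by case: NK => ->; [exact: ltn_ord|exact: I].
have [x [g [f [[gd g0] [fd f0] x1 xgf xs]]]] := disc_interpolation lt1 pK s1 mus.
have x01 j : 0 <= normc (x j) <= 1 by rewrite nc_ge0 ltW.
have [q pq qs] := is_prod_exists x01 xs NK.
suff : (L <= q%:E)%E.
  by move=> Lq; have := lt_le_trans sL Lq; rewrite lte_fin ltNge qs.
have nbE := nb_elem_prod1 b cA.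
apply: (lempert_admissible (e := fun j => (e j, b))); rewrite nbE.
  exact: set_bij_prod1.
exists x, (fun y => ((phi \o g) y, (psi \o f) y)); split=> //.
- by apply: holo_disc_pair; exact: holo_disc_comp.
- by rewrite /= g0 f0 phi0 psi0.
- by move=> j Nj; have [gx fx] := xgf j; rewrite /= gx fx psimu ltE // phil.
Qed.

End Upper.

(** * Poles on an affine disc, and the equivalence *)

Section Affine.
Variable R : realType.
Local Notation C := R[i].
Local Notation normc := (@Normc.normc R).
Implicit Types V W : normedModType C.

Lemma lempert_ge0 V (Om A : set V) x : (0 <= lempert Om A x)%E.
Proof.
apply: lempert_ge => e p be [l [phi [l1 _ _ _ pr]]]; rewrite lee_fin.
move: pr; case: (nb_elem A) => [n|] /= pr.
  by rewrite pr; apply: prodr_ge0 => j _; exact: nc_ge0.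
apply: (cvgr_to_ge pr); apply: nearW => k.
by apply: prodr_ge0 => j _; exact: nc_ge0.
Qed.

Lemma affine_poles V (D : set V) (z v : V) N (l : nat -> C) : v != 0 ->
  holo_disc D (fun x : C => z + x *: v) ->
  (forall j, indices N j -> normc (l j) < 1) -> set_inj (indices N) l ->
  exists A : set V, [/\ A `<=` D, countable A, nb_elem A = N &
    set_bij (indices N) A (fun j => z + l j *: v)].
Proof.
move=> v0 hD l1 li; exists [set z + l j *: v | j in indices N].
have bij : set_bij (indices N) [set z + l j *: v | j in indices N] (fun j => z + l j *: v).
  split; [by move=> j Nj; exists j| |by []].
  move=> i j iN jN /addrI/eqP; rewrite -subr_eq0 -scalerBl scaler_eq0.
  by rewrite (negbTE v0) orbF subr_eq0 => /eqP; exact: li.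
split=> //.
- by move=> _ [j Nj <-]; have [] := hD (l j); rewrite ?nc_lt1 ?l1.
- by apply: (@sub_countable _ _ _ (indices N)); [exact: card_image_le|exact: countableP].
- exact: set_bij_nb_elem bij.
Qed.

End Affine.

Local Close Scope complex_scope.

Theorem theorem5 (R : realType) (n m : nat) (n_gt0 : (0 < n)%N)
    (m_gt0 : (0 < m)%N) (D : set 'rV[R[i]]_n) (G : set 'rV[R[i]]_m)
    (domD : domain D) (domG : domain G)
    (z : 'rV[R[i]]_n) (w b : 'rV[R[i]]_m) (Dz : D z) (Gw : G w) (Gb : G b) :
  (forall A : set 'rV[R[i]]_n, A `<=` D -> A !=set0 -> countable A ->
     (maxe (lempert D A z) (lempertN G (nb_elem A) b w)
        <= lempert (D `*` G) (A `*` [set b]) (z, w))%E /\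
     (lempert (D `*` G) (A `*` [set b]) (z, w)
        <= maxe (lempert D A z) (lempert G [set b] w))%E) /\
  (forall N : option nat, N <> Some 0%N ->
     ((forall A : set 'rV[R[i]]_n, A `<=` D -> countable A -> nb_elem A = N ->
         lempert (D `*` G) (A `*` [set b]) (z, w)
         = maxe (lempert D A z) (lempert G [set b] w))
      <-> lempert G [set b] w = lempertN G N b w)).
Proof.
split=> [A AD A0 cA|N N0].
  by split; [exact: lempert_prod_ge|exact: lempert_prod_le].
split=> [eqA|eqN A AD cA AN]; last first.
  have A0 : A !=set0.
    apply/set0P/eqP => A0; apply: N0; rewrite -AN A0.
    rewrite /nb_elem; case: pselect => [f0|[]]; last exact: finite_set0.
    by rewrite fset_set0 cardfs0.
  apply/eqP; rewrite eq_le lempert_prod_le //=.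
  by rewrite eqN -AN; exact: lempert_prod_ge.
have [oD _ _] := domD.
have u0 : const_mx 1 != 0 :> 'rV[R[i]]_n.
  apply/eqP => /matrixP/(_ 0 (Ordinal n_gt0))/eqP.
  by rewrite !mxE oner_eq0.
have [v v0 hD] := holo_disc_affine oD Dz u0.
apply/eqP; rewrite eq_le; apply/andP; split.
  rewrite leNgt; apply/negP => /lempertN_lt[l [psi [p [[l1 li] hpsi psi0 psil [pr py]]]]].
  have [A [AD cA AN be]] := affine_poles v0 hD l1 li.
  have : (lempert (D `*` G) (A `*` [set b]) (z, w) <= p%:E)%E.
    have nbE := nb_elem_prod1 b cA.
    apply: (lempert_admissible (e := fun j => (z + l j *: v, b))); rewrite nbE AN.
      exact: set_bij_prod1.
    exists l, (fun x => (z + x *: v, psi x)); split=> //.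
    - exact: holo_disc_pair.
    - by rewrite scale0r addr0 psi0.
    - by move=> j Nj; rewrite psil.
  rewrite eqA // ge_max => /andP[_] /(lt_le_trans py).
  by rewrite ltxx.
(* Distinct parameters, the first one equal to 0. *)
pose l j : R[i] := ((1 - (j.+1%:R)^-1 : R)%:C)%C.
have lE j : Normc.normc (l j) = 1 - (j.+1%:R)^-1.
  by rewrite nc_real ger0_norm // subr_ge0 invf_le1 // ler1n.
have l1 j : indices N j -> Normc.normc (l j) < 1.
  by move=> _; rewrite lE ltrBlDr ltrDl invr_gt0.
have li : set_inj (indices N) l.
  move=> i j _ _ /complexI/addrI/oppr_inj/invr_inj/eqP.
  by rewrite eqr_nat eqSS => /eqP.
have [A [AD cA AN be]] := affine_poles v0 hD l1 li.
have Az : (lempert D A z <= 0)%E.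
  apply: (lempert_admissible (p := 0) (e := fun j => z + l j *: v)); rewrite AN //.
  exists l, (fun x => z + x *: v); split=> //; first by rewrite scale0r addr0.
  have p0 k : (0 < k)%N -> \prod_(j < k) Normc.normc (l j) = 0.
    by case: k => // k _; rewrite big_ord_recl /= lE invr1 subrr mul0r.
  case: N N0 {l1 li AN be eqA} => [k|] /= N0.
    by rewrite p0 // lt0n; apply/eqP => k0; apply: N0; rewrite k0.
  apply: (@cvg_trans _ (cst 0 @ \oo)); last exact: cvg_cst.
  by apply: near_eq_cvg; exists 1%N => // k k0; rewrite /= p0.
have A0 : A !=set0.
  have [ef _ _] := be; exists (z + l 0%N *: v); apply: ef.
  by case: N N0 {l1 li AN be eqA} => [[|k]|].
have h1 := lempert_prod_ge D G z w b cA.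
rewrite AN in h1.
apply: le_trans (le_trans h1 _); first by rewrite le_max lexx orbT.
apply: le_trans (lempert_prod_le D G z w b A0 cA) _.
rewrite ge_max lexx andbT; exact: le_trans Az (lempert_ge0 _ _ _).
Qed.
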